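(* For every entangled bipartite state $\rho$, $$\frac{E_D(\rho)}{E_c(\rho)}\le \mathcal S_E^{as}(\rho)\le 1,$$ equivalently $\dfrac{E_b(\rho)}{E_c(\rho)}\ge\mathcal A_E^{as}(\rho)$, where $E_b=E_c-E_D$. In particular, if $\mathcal A_E^{as}(\rho)>0$ then $E_D(\rho)<E_c(\rho)$.
   Context: $V$ is the swap of subsystems, $V(x\otimes y)=y\otimes x$. For bipartite states $\rho,\sigma$, the transition rate $R(\rho\to\sigma)$ is the supremum of all $r\ge0$ such that there exist LOCC operations $\Lambda_n$ and integers $m_n$ with $m_n/n\to r$ and $\|\Lambda_n(\rho^{\otimes n})-\sigma^{\otimes m_n}\|_1\to0$. The round-trip rate is $R(\rho\rightleftharpoons\sigma)=R(\rho\to\sigma)R(\sigma\to\rho)$ with $0\cdot\infty=\infty\cdot0=0$. The symmetry of entanglement is $\mathcal S_E^{as}(\rho)=R(\rho\to V\rho V^\dagger)$, which equals $\sup_\sigma R(\rho\rightleftharpoons\sigma)$ over all swap-invariant states $\sigma$ ($V\sigma V=\sigma$); the asymmetry of entanglement is $\mathcal A_E^{as}=1-\mathcal S_E^{as}$. With $\psi_+=\frac1{\sqrt2}(|00\rangle+|11\rangle)$, distillable entanglement is $E_D(\rho)=R(\rho\to\psi_+)$ and entanglement cost is $E_c(\rho)=1/R(\psi_+\to\rho)$; $E_c(\rho)>0$ for every entangled state $\rho$. *)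

(* Defs.v *)
From HB Require Import structures.
From mathcomp Require Import all_boot all_order all_algebra.
From mathcomp Require Import complex.
From mathcomp Require Import all_classical all_reals all_analysis.
Set Implicit Arguments. Unset Printing Implicit Defensive.
Import Order.TTheory GRing.Theory Num.Theory.
Import numFieldNormedType.Exports.
Local Open Scope classical_set_scope.
Local Open Scope ring_scope.

Section Quantum.
Variable R : realType.
Local Notation C := R[i].

(** Matrices with rows indexed by the finite type T and columns by U
    (i.e. linear maps C^U -> C^T in the computational bases). *)
Definition mat (T U : finType) := T -> U -> C.

Definition mulm (T U V : finType) (X : mat T U) (Y : mat U V) : mat T V :=
  fun i k => \sum_(j : U) X i j * Y j k.
Definition adjm (T U : finType) (X : mat T U) : mat U T :=
  fun j i => conjc (X i j).
Definition idm (T : finType) : mat T T := fun i j => (i == j)%:R.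
Definition subm (T U : finType) (X Y : mat T U) : mat T U :=
  fun i j => X i j - Y i j.
Definition trm (T : finType) (X : mat T T) : C := \sum_(i : T) X i i.
Definition kron (T U T' U' : finType) (X : mat T U) (Y : mat T' U')
  : mat (T * T')%type (U * U')%type := fun i j => X i.1 j.1 * Y i.2 j.2.
Definition sandw (T U : finType) (K : mat T U) (X : mat U U) : mat T T :=
  mulm (mulm K X) (adjm K).
Arguments mulm {T U V}.
Arguments adjm {T U}.
Arguments idm  T.
Arguments subm {T U}.
Arguments trm {T}.
Arguments kron {T U T' U'}.
Arguments sandw {T U}.

Definition psd (T : finType) (X : mat T T) : Prop :=
  forall v : T -> C, 0 <= \sum_(i : T) \sum_(j : T) conjc (v i) * X i j * v j.
Definition is_state (T : finType) (X : mat T T) : Prop := psd X /\ trm X = 1.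
Arguments psd {T}.
Arguments is_state {T}.

Definition unitary (T : finType) (U : mat T T) : Prop :=
  mulm (adjm U) U = @idm T.
Arguments unitary {T}.

(** Trace norm, through the variational formula ||X||_1 = sup_U |tr(U X)|
    over unitaries U. *)
Definition tnorm (T : finType) (X : mat T T) : R :=
  sup [set Normc.normc (trm (mulm U X)) | U in [set U | unitary U]].
Arguments tnorm {T}.

Definition tp_kraus (I T U : finType) (K : I -> mat T U) : Prop :=
  forall x y, \sum_(k : I) mulm (adjm (K k)) (K k) x y = @idm U x y.
Arguments tp_kraus {I T U}.

Definition bop (A B : finType) := mat (A * B)%type (A * B)%type.

(** Finite-round LOCC channels from the bipartite system A:B to A':B'.
    - local: a product of local channels (given by Kraus families)
    - Alice (resp. Bob) performs an instrument with outcomes I (each outcome i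
      with Kraus operators K i j, j : J), broadcasts the outcome, and the
      protocol continues with an LOCC channel Psi i depending on i. *)
Inductive LOCC : forall (A B A' B' : finType), (bop A B -> bop A' B') -> Prop :=
| LOCC_local (A B A' B' I J : finType) (K : I -> mat A' A) (L : J -> mat B' B) :
    tp_kraus K -> tp_kraus L ->
    LOCC (fun X => fun x y =>
            \sum_(i : I) \sum_(j : J) sandw (kron (K i) (L j)) X x y)
| LOCC_Alice (A B A'' A' B' I J : finType) (K : I -> J -> mat A'' A)
    (Psi : I -> bop A'' B -> bop A' B') :
    tp_kraus (fun ij : (I * J)%type => K ij.1 ij.2) ->
    (forall i, LOCC (Psi i)) ->
    LOCC (fun X => fun x y =>
            \sum_(i : I) Psi i (fun u v =>
               \sum_(j : J) sandw (kron (K i j) (@idm B)) X u v) x y)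
| LOCC_Bob (A B B'' A' B' I J : finType) (L : I -> J -> mat B'' B)
    (Psi : I -> bop A B'' -> bop A' B') :
    tp_kraus (fun ij : (I * J)%type => L ij.1 ij.2) ->
    (forall i, LOCC (Psi i)) ->
    LOCC (fun X => fun x y =>
            \sum_(i : I) Psi i (fun u v =>
               \sum_(j : J) sandw (kron (@idm A) (L i j)) X u v) x y).

Definition tpow (A B : finType) (rho : bop A B) (n : nat)
  : bop {ffun 'I_n -> A} {ffun 'I_n -> B} :=
  fun x y => \prod_(k < n) rho (x.1 k, x.2 k) (y.1 k, y.2 k).
Arguments tpow {A B}.

Definition achievable (A B A' B' : finType) (rho : bop A B) (sigma : bop A' B')
  (r : R) : Prop :=
  0 <= r /\
  exists (m : nat -> nat)
    (Lam : forall n, bop {ffun 'I_n -> A} {ffun 'I_n -> B} ->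
                     bop {ffun 'I_(m n) -> A'} {ffun 'I_(m n) -> B'}),
    (forall n, LOCC (Lam n)) /\
    ((fun n => (m n)%:R / n%:R : R) @ \oo --> r) /\
    ((fun n => tnorm (subm (Lam n (tpow rho n)) (tpow sigma (m n)))) @ \oo
       --> (0 : R)).
Arguments achievable {A B A' B'}.

Definition rate (A B A' B' : finType) (rho : bop A B) (sigma : bop A' B')
  : \bar R := ereal_sup [set r%:E | r in achievable rho sigma].
Arguments rate {A B A' B'}.

Definition swapop (A B : finType) (rho : bop A B) : bop B A :=
  fun x y => rho (x.2, x.1) (y.2, y.1).
Arguments swapop {A B}.

Definition psi_plus : bop 'I_2 'I_2 :=
  fun x y => if (x.1 == x.2) && (y.1 == y.2) then 2^-1 else 0.
Arguments psi_plus .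

Definition E_D (A B : finType) (rho : bop A B) : \bar R := rate rho psi_plus.
Definition E_c (A B : finType) (rho : bop A B) : \bar R :=
  ((rate psi_plus rho)^-1)%E.
Definition E_b (A B : finType) (rho : bop A B) : \bar R :=
  (E_c rho - E_D rho)%E.
Definition sym_ent (A B : finType) (rho : bop A B) : \bar R :=
  rate rho (swapop rho).
Definition asym_ent (A B : finType) (rho : bop A B) : \bar R :=
  (1 - sym_ent rho)%E.
Arguments E_D {A B}.
Arguments E_c {A B}.
Arguments E_b {A B}.
Arguments sym_ent {A B}.
Arguments asym_ent {A B}.

Definition separable (A B : finType) (rho : bop A B) : Prop :=
  exists (k : nat) (p : 'I_k -> R) (alpha : 'I_k -> mat A A)
         (beta : 'I_k -> mat B B),
    (forall i, 0 <= p i) /\ \sum_(i < k) p i = 1 /\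
    (forall i, is_state (alpha i) /\ is_state (beta i)) /\
    forall x y, rho x y = \sum_(i < k) Complex (p i) 0 * kron (alpha i) (beta i) x y.
Arguments separable {A B}.

Definition entangled (A B : finType) (rho : bop A B) : Prop :=
  is_state rho /\ ~ separable rho.
Arguments entangled {A B}.

End Quantum.

Arguments mulm {R T U V}.
Arguments adjm {R T U}.
Arguments idm {R} T.
Arguments subm {R T U}.
Arguments trm {R T}.
Arguments kron {R T U T' U'}.
Arguments sandw {R T U}.
Arguments psd {R T}.
Arguments is_state {R T}.
Arguments unitary {R T}.
Arguments tnorm {R T}.
Arguments tp_kraus {R I T U}.
Arguments tpow {R A B}.
Arguments achievable {R A B A' B'}.
Arguments rate {R A B A' B'}.
Arguments swapop {R A B}.
Arguments psi_plus {R}.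
Arguments E_D {R A B}.
Arguments E_c {R A B}.
Arguments E_b {R A B}.
Arguments sym_ent {R A B}.
Arguments asym_ent {R A B}.
Arguments separable {R A B}.
Arguments entangled {R A B}.

(* Main.v *)
Require Import Defs.
From mathcomp Require Import all_boot all_order all_algebra.
From mathcomp Require Import spectral complex.
From mathcomp Require Import all_classical all_reals all_analysis.
From mathcomp Require Import ring lra.

(** Rates multiply along a chain of transformations, and rates do not change when
    both states are swapped. As psi_+ is invariant under the swap,
    R(rho -> psi_+) R(psi_+ -> rho) <= R(rho -> V rho V) and
    R(psi_+ -> rho) R(rho -> V rho V) <= R(psi_+ -> rho), which gives everything
    once 0 < R(psi_+ -> rho) < +oo. Positivity is teleportation.

    Finiteness says that entangled states have positive cost. An entangled rho is
    separated from the separable states by a local measurement: there is a weight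
    g > 0 on the outcomes whose mean is at most 1 on every product vector, while
    the mean of 1 / g on rho is some a < 1. On m copies the test
    "the product of the weights is at least t ^ m", with 1 < t < 1 / a, accepts
    rho with probability at least 1 - (t a) ^ m. A product vector passes with
    probability at most t ^ -m, because measuring one copy of a product vector
    leaves a product vector, so any state obtained from n copies of psi_+ by LOCC
    passes with probability at most 2 ^ n t ^ -m. *)

Set Implicit Arguments. Unset Strict Implicit. Unset Printing Implicit Defensive.
Import Order.TTheory GRing.Theory Num.Theory.
Import numFieldNormedType.Exports.
Local Open Scope classical_set_scope.
Local Open Scope ring_scope.
Local Open Scope complex_scope.
Local Notation Re := complex.Re.
Local Notation Im := complex.Im.
Local Notation normc := Normc.normc.
Local Notation polar_index T := (T * T * 'I_4)%type.
Local Notation copies R A B n := (bop R {ffun 'I_n -> A} {ffun 'I_n -> B}).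

(** * Complex numbers and finite sums *)

Section ComplexModulus.
Variable R : realType.
Local Notation C := R[i].
Implicit Types z : C.

Lemma conjcM z z' : conjc (z * z') = conjc z * conjc z'.
Proof. exact: rmorphM. Qed.

Lemma mulcJ z : z * conjc z = (normc z ^+ 2)%:C.
Proof.
by case: z => a b; rewrite sqr_sqrtr ?addr_ge0 ?sqr_ge0//; simpc; congr Complex; ring.
Qed.

Lemma sqr_normcE z : normc z ^+ 2 = Re z ^+ 2 + Im z ^+ 2.
Proof. by case: z => a b; rewrite sqr_sqrtr ?addr_ge0 ?sqr_ge0. Qed.

Lemma normc_ge0 z : 0 <= normc z.
Proof. by case: z => a b; exact: sqrtr_ge0. Qed.

Lemma normc_conjc z : normc (conjc z) = normc z.
Proof. by case: z => a b; rewrite /= sqrrN. Qed.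

Lemma normc_real (x : R) : normc x%:C = `|x|.
Proof. by rewrite /= expr0n /= addr0 sqrtr_sqr. Qed.

Lemma sqr_sqrt_invn (n : nat) :
  (Num.sqrt n%:R^-1 : R)%:C * (Num.sqrt n%:R^-1 : R)%:C = n%:R^-1 :> C.
Proof. by rewrite -rmorphM -expr2 sqr_sqrtr ?invr_ge0// fmorphV rmorph_nat. Qed.

Lemma Re_le_normc z : Re z <= normc z.
Proof.
case: z => a b; rewrite (le_trans (ler_norm _))// -sqrtr_sqr ler_wsqrtr//.
by rewrite lerDl sqr_ge0.
Qed.

Lemma normc_sum (I : Type) (s : seq I) (P : pred I) (F : I -> C) :
  normc (\sum_(i <- s | P i) F i) <= \sum_(i <- s | P i) normc (F i).
Proof.
elim/big_rec2: _ => [|i x z _ h]; first by rewrite Normc.normc0.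
by rewrite (le_trans (le_normcD _ _))// lerD2l.
Qed.

Lemma Re_sum (I : Type) (s : seq I) (P : pred I) (F : I -> C) :
  Re (\sum_(i <- s | P i) F i) = \sum_(i <- s | P i) Re (F i).
Proof. exact: (raddf_sum (@complex.Re R : Rcomplex R -> R)). Qed.

Lemma Im_sum (I : Type) (s : seq I) (P : pred I) (F : I -> C) :
  Im (\sum_(i <- s | P i) F i) = \sum_(i <- s | P i) Im (F i).
Proof. exact: (raddf_sum (@complex.Im R : Rcomplex R -> R)). Qed.

Lemma sqr_normc_sum_le (I : finType) (F : I -> C) :
  normc (\sum_i F i) ^+ 2 <= #|I|%:R * \sum_i normc (F i) ^+ 2.
Proof.
have sum_ge0 : 0 <= \sum_i normc (F i) by rewrite sumr_ge0// => i _; exact: normc_ge0.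
apply: (@le_trans _ _ ((\sum_i normc (F i)) ^+ 2)).
  by rewrite lerXn2r ?nnegrE ?normc_ge0 ?normc_sum.
have -> : #|I|%:R * \sum_i normc (F i) ^+ 2 =
    \sum_i \sum_j (normc (F i) ^+ 2 + normc (F j) ^+ 2) / 2.
  under [RHS]eq_bigr => i _ do rewrite -mulr_suml big_split /= sumr_const.
  by rewrite -mulr_suml big_split /= sumrMnl sumr_const -mulrnDl -mulr_natl; field.
rewrite expr2 mulr_suml; apply: ler_sum => i _; rewrite mulr_sumr; apply: ler_sum => j _.
by have := sqr_ge0 (normc (F i) - normc (F j)); lra.
Qed.

End ComplexModulus.

Section FiniteSums.

Lemma sum_pair (V : nmodType) (T U : finType) (F : T * U -> V) :
  \sum_p F p = \sum_i \sum_j F (i, j).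
Proof. by rewrite pair_bigA; apply: eq_bigr => -[]. Qed.

Lemma sum_unit (V : nmodType) (F : unit -> V) : \sum_i F i = F tt.
Proof. by rewrite (big_pred1 tt) //; case. Qed.

Lemma sum_swap (V : nmodType) (T U : finType) (F : T * U -> V) :
  \sum_p F p = \sum_(q : U * T) F (q.2, q.1).
Proof. by rewrite !sum_pair exchange_big. Qed.

Lemma sum_delta (V : pzSemiRingType) (T : finType) (x : T) (F : T -> V) :
  \sum_y (x == y)%:R * F y = F x.
Proof.
rewrite (bigD1 x) //= eqxx mul1r big1 ?addr0// => y.
by rewrite eq_sym => /negPf ->; rewrite mul0r.
Qed.

Lemma prod_sum_pair (V : comPzSemiRingType) (n : nat) (A B : finType)
    (F : 'I_n -> A * B -> V) :
  \prod_(k < n) \sum_p F k p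
  = \sum_(x : {ffun 'I_n -> A} * {ffun 'I_n -> B}) \prod_(k < n) F k (x.1 k, x.2 k).
Proof.
under eq_bigr do rewrite sum_pair.
rewrite bigA_distr_bigA sum_pair /=; apply: eq_bigr => f _.
by rewrite bigA_distr_bigA.
Qed.

Lemma prod_delta (V : comPzSemiRingType) n (T : finType) (f g : {ffun 'I_n -> T}) :
  \prod_k (f k == g k)%:R = (f == g)%:R :> V.
Proof.
have [->|/eqP nfg] := eqVneq f g; first by rewrite big1// => k _; rewrite eqxx.
have [k nk] : exists k, f k != g k.
  apply/existsP; rewrite -negb_forall; apply/negP => /forallP fg.
  by apply: nfg; apply/ffunP => k; apply/eqP.
by rewrite (bigD1 k) //= (negPf nk) mul0r.
Qed.

End FiniteSums.

(** * Matrices indexed by finite types *)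

Section MatrixAlgebra.
Variable R : realType.
Local Notation C := R[i].
Local Notation mat := (mat R).
Implicit Types T U V Z I : finType.

Lemma matP T U (X Y : mat T U) : (forall i j, X i j = Y i j) -> X = Y.
Proof. by move=> h; apply/funext => i; apply/funext => j. Qed.

Definition mx_of T U (X : mat T U) : 'M[C]_(#|T|, #|U|) :=
  \matrix_(i, j) X (enum_val i) (enum_val j).

Lemma mx_of_inj T U : injective (@mx_of T U).
Proof.
move=> X Y /matrixP eXY; apply: matP => i j.
by have := eXY (enum_rank i) (enum_rank j); rewrite !mxE !enum_rankK.
Qed.

Lemma mx_of_mulm T U V (X : mat T U) (Y : mat U V) :
  mx_of (mulm X Y) = mx_of X *m mx_of Y.
Proof.
apply/matrixP => i j; rewrite !mxE /mulm (reindex (@enum_val U U)) /=.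
  by apply: eq_bigr => k _; rewrite !mxE.
exact: onW_bij (enum_val_bij U).
Qed.

Lemma mx_of_idm T : mx_of (idm T) = 1%:M.
Proof. by apply/matrixP => i j; rewrite !mxE /idm (inj_eq enum_val_inj). Qed.

Lemma mx_of_subm T U (X Y : mat T U) : mx_of (subm X Y) = mx_of X - mx_of Y.
Proof. by apply/matrixP => i j; rewrite !mxE. Qed.

Lemma mxtrace_mx_of T (X : mat T T) : \tr (mx_of X) = trm X.
Proof.
rewrite /trm (reindex (@enum_val T T)) /=; first by apply: eq_bigr => k _; rewrite mxE.
exact: onW_bij (enum_val_bij T).
Qed.

Lemma mulmA T U V Z (X : mat T U) (Y : mat U V) (W : mat V Z) :
  mulm X (mulm Y W) = mulm (mulm X Y) W.
Proof. by apply: mx_of_inj; rewrite !mx_of_mulm mulmxA. Qed.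

Lemma mulm1 T U (X : mat T U) : mulm X (idm U) = X.
Proof. by apply: mx_of_inj; rewrite mx_of_mulm mx_of_idm mulmx1. Qed.

Lemma mul1m T U (X : mat T U) : mulm (idm T) X = X.
Proof. by apply: mx_of_inj; rewrite mx_of_mulm mx_of_idm mul1mx. Qed.

Lemma mulm1C T (X Y : mat T T) : mulm X Y = idm T -> mulm Y X = idm T.
Proof.
move=> h; apply: mx_of_inj; rewrite mx_of_mulm mx_of_idm; apply: mulmx1C.
by rewrite -mx_of_mulm h mx_of_idm.
Qed.

Lemma mulm_subr T U V (X : mat T U) (Y Z : mat U V) :
  mulm X (subm Y Z) = subm (mulm X Y) (mulm X Z).
Proof. by apply: mx_of_inj; rewrite !(mx_of_mulm, mx_of_subm) mulmxBr. Qed.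

Lemma mulm_subl T U V (X Y : mat T U) (Z : mat U V) :
  mulm (subm X Y) Z = subm (mulm X Z) (mulm Y Z).
Proof. by apply: mx_of_inj; rewrite !(mx_of_mulm, mx_of_subm) mulmxBl. Qed.

Lemma trm_mulmC T U (X : mat T U) (Y : mat U T) : trm (mulm X Y) = trm (mulm Y X).
Proof. by rewrite -!mxtrace_mx_of !mx_of_mulm mxtrace_mulC. Qed.

Lemma trm_subm T (X Y : mat T T) : trm (subm X Y) = trm X - trm Y.
Proof. by rewrite -!mxtrace_mx_of mx_of_subm raddfB. Qed.

Lemma trm1_inhabited T (X : mat T T) : trm X = 1 -> inhabited T.
Proof.
move=> X1; suff /card_gt0P[x _] : (0 < #|T|)%N by exists.
rewrite lt0n; apply/eqP => T0; move: X1; rewrite /trm big_pred0.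
  by move/eqP; rewrite eq_sym oner_eq0.
by move=> x; have := fintype0 x; rewrite T0 => /(_ erefl).
Qed.

Lemma adjmK T U (X : mat T U) : adjm (adjm X) = X.
Proof. by apply: matP => i j; rewrite /adjm conjcK. Qed.

Lemma adjm1 T : adjm (idm T) = idm T :> mat T T.
Proof. by apply: matP => i j; rewrite /adjm /idm conjc_nat eq_sym. Qed.

Lemma adjm_mulm T U V (X : mat T U) (Y : mat U V) :
  adjm (mulm X Y) = mulm (adjm Y) (adjm X).
Proof.
apply: matP => i j; rewrite /mulm /adjm rmorph_sum.
by apply: eq_bigr => k _; rewrite rmorphM mulrC.
Qed.

Lemma adjm_subm T U (X Y : mat T U) : adjm (subm X Y) = subm (adjm X) (adjm Y).
Proof. by apply: matP => i j; rewrite /adjm /subm rmorphB. Qed.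

Lemma sandwE T U (K : mat T U) (X : mat U U) x y :
  sandw K X x y = \sum_i \sum_j K x i * X i j * conjc (K y j).
Proof.
rewrite /sandw /mulm /adjm exchange_big; apply: eq_bigr => j _ /=.
by rewrite mulr_suml.
Qed.

Lemma sandw_mulm T U V (K : mat T U) (L : mat U V) X :
  sandw (mulm K L) X = sandw K (sandw L X).
Proof. by rewrite /sandw adjm_mulm !mulmA. Qed.

Lemma sandw1 T (X : mat T T) : sandw (idm T) X = X.
Proof. by rewrite /sandw adjm1 mulm1 mul1m. Qed.

Lemma adjm_sandw T U (K : mat T U) X : adjm (sandw K X) = sandw K (adjm X).
Proof. by rewrite /sandw !adjm_mulm adjmK mulmA. Qed.

Lemma sandw_subm T U (K : mat T U) X Y :
  sandw K (subm X Y) = subm (sandw K X) (sandw K Y).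
Proof. by rewrite /sandw mulm_subr mulm_subl. Qed.

Lemma trm_sandw T U (M : mat T T) (K : mat T U) (X : mat U U) :
  trm (mulm M (sandw K X)) = trm (mulm (sandw (adjm K) M) X).
Proof. by rewrite /sandw adjmK !mulmA trm_mulmC !mulmA. Qed.

Definition summ I T U (X : I -> mat T U) : mat T U := fun i j => \sum_k X k i j.

Lemma mulm_summr I T U V (X : mat T U) (Y : I -> mat U V) :
  mulm X (summ Y) = summ (fun k => mulm X (Y k)).
Proof.
apply: matP => i j; rewrite /mulm /summ exchange_big /=.
by apply: eq_bigr => k _; rewrite mulr_sumr.
Qed.

Lemma mulm_summl I T U V (X : I -> mat T U) (Y : mat U V) :
  mulm (summ X) Y = summ (fun k => mulm (X k) Y).
Proof.
apply: matP => i j; rewrite /mulm /summ exchange_big /=.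
by apply: eq_bigr => k _; rewrite mulr_suml.
Qed.

Lemma sandw_summ I T U (K : mat T U) (X : I -> mat U U) :
  sandw K (summ X) = summ (fun k => sandw K (X k)).
Proof. by rewrite /sandw mulm_summr mulm_summl. Qed.

Lemma trm_summ I T (X : I -> mat T T) : trm (summ X) = \sum_k trm (X k).
Proof. exact: exchange_big. Qed.

Lemma adjm_summ I T U (X : I -> mat T U) : adjm (summ X) = summ (fun k => adjm (X k)).
Proof. by apply: matP => i j; exact: rmorph_sum. Qed.

Lemma summ_subm I T U (X Y : I -> mat T U) :
  summ (fun k => subm (X k) (Y k)) = subm (summ X) (summ Y).
Proof. by apply: matP => i j; rewrite /summ /subm sumrB. Qed.

Lemma mulm_kron (T U V T' U' V' : finType) (K : mat T U) (L : mat U V)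
    (K' : mat T' U') (L' : mat U' V') :
  mulm (kron K K') (kron L L') = kron (mulm K L) (mulm K' L').
Proof.
apply: matP => i j; rewrite /mulm /kron sum_pair mulr_suml /=.
by apply: eq_bigr => k _; rewrite mulr_sumr; apply: eq_bigr => l _; ring.
Qed.

Lemma adjm_kron (T U T' U' : finType) (K : mat T U) (K' : mat T' U') :
  adjm (kron K K') = kron (adjm K) (adjm K').
Proof. by apply: matP => i j; rewrite /adjm /kron rmorphM. Qed.

Lemma kron1 T U : kron (idm T) (idm U) = idm (T * U)%type :> mat _ _.
Proof. by apply: matP => -[i i'] [j j']; rewrite /kron /idm -natrM mulnb. Qed.

Lemma kron_split (T U T' U' : finType) (K : mat T U) (L : mat T' U') :
  kron K L = mulm (kron (idm T) L) (kron K (idm U')).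
Proof. by rewrite mulm_kron mulm1 mul1m. Qed.

End MatrixAlgebra.

(** * Vectors and quadratic forms *)

Section Vectors.
Variable R : realType.
Local Notation C := R[i].
Local Notation mat := (mat R).
Implicit Types T U V I : finType.

Definition braket T (u v : T -> C) : C := \sum_i conjc (u i) * v i.
Definition sqnorm T (u : T -> C) : R := \sum_i normc (u i) ^+ 2.
Definition mulmv T U (K : mat T U) (w : U -> C) : T -> C := fun x => \sum_i K x i * w i.
Definition qform T (X : mat T T) (w : T -> C) : C :=
  \sum_i \sum_j conjc (w i) * X i j * w j.
Definition ketbra T (w : T -> C) : mat T T := fun i j => w i * conjc (w j).
Definition basis_vec T (t : T) : T -> C := fun i => (i == t)%:R.
Definition pvec T U (a : T -> C) (b : U -> C) : T * U -> C := fun p => a p.1 * b p.2.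

Lemma braketvv T (u : T -> C) : braket u u = (sqnorm u)%:C.
Proof. by rewrite rmorph_sum; apply: eq_bigr => i _; rewrite mulrC mulcJ. Qed.

Lemma conjc_braket T (u v : T -> C) : conjc (braket u v) = braket v u.
Proof. by rewrite rmorph_sum; apply: eq_bigr => i _; rewrite /= conjcM conjcK mulrC. Qed.

Lemma braket_mulmv T U (K : mat T U) u w :
  braket u (mulmv K w) = braket (mulmv (adjm K) u) w.
Proof.
rewrite /braket /mulmv; under eq_bigr do rewrite mulr_sumr.
rewrite exchange_big; apply: eq_bigr => j _; rewrite rmorph_sum mulr_suml.
by apply: eq_bigr => i _; rewrite /= conjcM conjcK; ring.
Qed.

Lemma mulmv_mulm T U V (K : mat T U) (L : mat U V) w :
  mulmv (mulm K L) w = mulmv K (mulmv L w).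
Proof.
apply/funext => x; rewrite /mulmv /mulm; under eq_bigr do rewrite mulr_suml.
rewrite exchange_big; apply: eq_bigr => j _; rewrite mulr_sumr.
by apply: eq_bigr => i _; rewrite mulrA.
Qed.

Lemma mul1mv T (w : T -> C) : mulmv (idm T) w = w.
Proof. by apply/funext => x; rewrite /mulmv sum_delta. Qed.

Lemma mulmv_basis T U (K : mat T U) t : mulmv K (basis_vec t) = K ^~ t.
Proof.
apply/funext => x; rewrite /mulmv -[RHS](sum_delta t).
by apply: eq_bigr => i _; rewrite mulrC eq_sym.
Qed.

Lemma qformE T (X : mat T T) w : qform X w = braket w (mulmv X w).
Proof.
by apply: eq_bigr => i _; rewrite mulr_sumr; apply: eq_bigr => j _; rewrite mulrA.
Qed.

Lemma qform_basis T (X : mat T T) t : qform X (basis_vec t) = X t t.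
Proof.
rewrite qformE mulmv_basis /braket -[RHS](sum_delta t (X ^~ t)).
by apply: eq_bigr => i _; rewrite conjc_nat eq_sym.
Qed.

Lemma qform_sandw T U (K : mat T U) (X : mat U U) w :
  qform (sandw K X) w = qform X (mulmv (adjm K) w).
Proof. by rewrite !qformE /sandw !mulmv_mulm braket_mulmv. Qed.

Lemma qform_adjm T (X : mat T T) w : qform (adjm X) w = conjc (qform X w).
Proof. by rewrite !qformE braket_mulmv adjmK conjc_braket. Qed.

Lemma qform_summ T I (X : I -> mat T T) w : qform (summ X) w = \sum_k qform (X k) w.
Proof.
rewrite /qform [RHS]exchange_big; apply: eq_bigr => i _ /=.
by rewrite [RHS]exchange_big; apply: eq_bigr => j _; rewrite mulr_sumr mulr_suml.
Qed.

Lemma qform_subm T (X Y : mat T T) w : qform (subm X Y) w = qform X w - qform Y w.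
Proof.
rewrite /qform -sumrB; apply: eq_bigr => i _; rewrite -sumrB.
by apply: eq_bigr => j _; rewrite /subm mulrBr mulrBl.
Qed.

Lemma qform_ketbra T (a w : T -> C) : qform (ketbra a) w = (normc (braket a w) ^+ 2)%:C.
Proof.
rewrite -mulcJ conjc_braket /braket mulr_suml /qform exchange_big.
apply: eq_bigr => i _; rewrite /= mulr_sumr.
by apply: eq_bigr => j _; rewrite /ketbra; ring.
Qed.

Lemma sandw_ketbra T U (K : mat T U) w : sandw K (ketbra w) = ketbra (mulmv K w).
Proof.
apply: matP => x y; rewrite sandwE /ketbra /mulmv rmorph_sum mulr_suml.
apply: eq_bigr => i _; rewrite mulr_sumr.
by apply: eq_bigr => j _; rewrite rmorphM; ring.
Qed.

Lemma trm_ketbra T (w : T -> C) : trm (ketbra w) = (sqnorm w)%:C.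
Proof. by rewrite rmorph_sum; apply: eq_bigr => i _; exact: mulcJ. Qed.

Lemma sqnorm_ge0 T (w : T -> C) : 0 <= sqnorm w.
Proof. by rewrite sumr_ge0// => i _; exact: sqr_ge0. Qed.

Lemma normc_le_sqnorm T (w : T -> C) i : normc (w i) ^+ 2 <= sqnorm w.
Proof. by rewrite /sqnorm (bigD1 i) //= lerDl sumr_ge0// => j _; exact: sqr_ge0. Qed.

Lemma sqnorm_eq0 T (w : T -> C) : sqnorm w = 0 -> forall i, w i = 0.
Proof.
move=> w0 i; apply: Normc.eq0_normc; apply/eqP; rewrite -sqrf_eq0 eq_le sqr_ge0 andbT.
by rewrite -w0 normc_le_sqnorm.
Qed.

Lemma sqnormZ T (r : R) (w : T -> C) : sqnorm (fun i => r%:C * w i) = r ^+ 2 * sqnorm w.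
Proof.
rewrite /sqnorm mulr_sumr; apply: eq_bigr => i _.
by rewrite Normc.normcM normc_real exprMn real_normK ?num_real.
Qed.

Lemma sqnorm_pvec T U (a : T -> C) (b : U -> C) : sqnorm (pvec a b) = sqnorm a * sqnorm b.
Proof.
rewrite /sqnorm sum_pair mulr_suml; apply: eq_bigr => i _; rewrite mulr_sumr.
by apply: eq_bigr => j _; rewrite Normc.normcM exprMn.
Qed.

Lemma mulmv_kron_pvec (T U T' U' : finType) (K : mat T U) (K' : mat T' U') a b :
  mulmv (kron K K') (pvec a b) = pvec (mulmv K a) (mulmv K' b).
Proof.
apply/funext => x; rewrite /mulmv /pvec sum_pair mulr_suml; apply: eq_bigr => i _.
by rewrite mulr_sumr; apply: eq_bigr => j _; rewrite /kron /=; ring.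
Qed.

Lemma qform_idm T (w : T -> C) : qform (idm T) w = (sqnorm w)%:C.
Proof. by rewrite qformE mul1mv braketvv. Qed.

Lemma sqnorm_basis T (t : T) : sqnorm (basis_vec t) = 1.
Proof. by apply: complexI; rewrite -qform_idm qform_basis /idm eqxx. Qed.

Lemma sqnorm_mulmv T U (K : mat T U) w :
  (sqnorm (mulmv K w))%:C = qform (mulm (adjm K) K) w.
Proof. by rewrite -braketvv qformE mulmv_mulm [RHS]braket_mulmv adjmK. Qed.

End Vectors.

Arguments basis_vec {R T}.

Section Isometries.
Variable R : realType.
Local Notation mat := (mat R).
Implicit Types T U : finType.

Definition isometric T U (V : mat T U) := mulm (adjm V) V = idm U.

Lemma isometric1 T : isometric (@idm R T).
Proof. by rewrite /isometric mulm1 adjm1. Qed.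

Lemma sqnorm_isometric T U (V : mat T U) w : isometric V -> sqnorm (mulmv V w) = sqnorm w.
Proof. by move=> hV; apply: complexI; rewrite sqnorm_mulmv hV qform_idm. Qed.

Lemma isometric_col T U (V : mat T U) k : isometric V -> sqnorm (V ^~ k) = 1.
Proof. by move=> hV; rewrite -mulmv_basis sqnorm_isometric// sqnorm_basis. Qed.

Lemma isometric_kron (T U T' U' : finType) (V : mat T U) (V' : mat T' U') :
  isometric V -> isometric V' -> isometric (kron V V').
Proof. by move=> hV hV'; rewrite /isometric adjm_kron mulm_kron hV hV' kron1. Qed.

Lemma trm_sandw_isometric T U (V : mat T U) (X : mat U U) :
  isometric V -> trm (sandw V X) = trm X.
Proof. by move=> hV; rewrite /sandw -mulmA trm_mulmC -mulmA hV mulm1. Qed.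

Lemma sandw_adjmK T U (V : mat T U) (X : mat U U) :
  isometric V -> sandw (adjm V) (sandw V X) = X.
Proof. by move=> hV; rewrite -sandw_mulm hV sandw1. Qed.

Lemma mulm_sandw T U (V : mat T U) (X Y : mat U U) : isometric V ->
  mulm (sandw V X) (sandw V Y) = sandw V (mulm X Y).
Proof.
move=> hV; rewrite /sandw !mulmA; congr mulm; congr mulm.
by rewrite -[LHS]mulmA hV mulm1.
Qed.

Lemma sandw_adjm_diag T U (V : mat T U) (M : mat T T) k :
  sandw (adjm V) M k k = qform M (V ^~ k).
Proof. by rewrite sandwE; do 2 apply: eq_bigr => ? _; rewrite /adjm conjcK. Qed.

End Isometries.

(** * Hermitian matrices and the trace norm *)

Section Hermitian.
Variable R : realType.
Local Notation C := R[i].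
Local Notation mat := (mat R).
Implicit Types T U I : finType.

Definition herm T (X : mat T T) := adjm X = X.
Definition diagm T (d : T -> R) : mat T T := fun i j => (d i)%:C * (i == j)%:R.

Lemma herm_subm T (X Y : mat T T) : herm X -> herm Y -> herm (subm X Y).
Proof. by move=> hX hY; rewrite /herm adjm_subm hX hY. Qed.

Lemma herm_sandw T U (K : mat T U) X : herm X -> herm (sandw K X).
Proof. by move=> hX; rewrite /herm adjm_sandw hX. Qed.

Lemma herm_summ I T (X : I -> mat T T) : (forall k, herm (X k)) -> herm (summ X).
Proof. by move=> hX; rewrite /herm adjm_summ; congr summ; apply/funext => k; exact: hX. Qed.

Lemma herm_diagm T (d : T -> R) : herm (diagm d).
Proof.
apply: matP => i j; rewrite /adjm /diagm conjcM conjc_real conjc_nat eq_sym.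
by case: eqP => [->|]; rewrite ?mulr0.
Qed.

Lemma mulm_diagm T (d e : T -> R) : mulm (diagm d) (diagm e) = diagm (fun k => d k * e k).
Proof.
apply: matP => i j; rewrite /mulm -[RHS]mulr1 -(sum_delta i (fun=> _ * 1)).
apply: eq_bigr => k _; rewrite /diagm rmorphM.
by case: eqP => [->|_]; rewrite ?mulr1 ?mulr0 ?mul0r ?mul1r ?mulrA.
Qed.

Lemma diagm1 T : diagm (fun=> 1) = idm T.
Proof. by apply: matP => i j; rewrite /diagm mul1r. Qed.

Lemma qform_diagm T (d : T -> R) w : qform (diagm d) w = (\sum_k d k * normc (w k) ^+ 2)%:C.
Proof.
rewrite rmorph_sum; apply: eq_bigr => i _; rewrite rmorphM /= -mulcJ.
rewrite -(sum_delta i (fun j => (d i)%:C * (w j * conjc (w i)))).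
by apply: eq_bigr => j _; rewrite /diagm; ring.
Qed.

Lemma trm_mulm_diagm T (M : mat T T) (d : T -> R) :
  trm (mulm M (diagm d)) = \sum_k (d k)%:C * M k k.
Proof.
rewrite trm_mulmC /trm /mulm; apply: eq_bigr => i _.
rewrite -(sum_delta i (fun j => (d i)%:C * M j i)); apply: eq_bigr => j _.
by rewrite /diagm mulrCA mulrA.
Qed.

Lemma trm_diagm T (d : T -> R) : trm (diagm d) = (\sum_k d k)%:C.
Proof. by rewrite rmorph_sum; apply: eq_bigr => i _; rewrite /diagm eqxx mulr1. Qed.

Lemma sandw_diagmE T U (W : mat T U) d i j :
  sandw W (diagm d) i j = \sum_k (d k)%:C * (W i k * conjc (W j k)).
Proof.
rewrite sandwE; apply: eq_bigr => k _.
rewrite -(sum_delta k (fun l => (d k)%:C * (W i k * conjc (W j l)))).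
by apply: eq_bigr => l _; rewrite /diagm; ring.
Qed.

Lemma herm_spectral T (X : mat T T) : herm X ->
  exists2 W : mat T T, unitary W & exists d, X = sandw W (diagm d).
Proof.
move=> hX; pose A := mx_of X.
have hA : A \is hermsymmx.
  apply/is_hermitianmxP; rewrite expr0 scale1r; apply/matrixP => i j.
  by rewrite !mxE -{1}hX.
have := hermitian_normalmx hA; have hP := spectral_unitarymx A.
have /mxOverP hD := hermitian_spectral_diag_real hA.
move/orthomx_spectralP; rewrite invmx_unitary//.
set P := spectralmx A in hP *; set D := spectral_diag A in hD * => eA.
pose W : mat T T := fun i k => conjc (P (enum_rank k) (enum_rank i)).
pose d k := Re (D 0 (enum_rank k)).
have eW : mx_of W = (P^t*)%sesqui by apply/matrixP => i j; rewrite !mxE /W !enum_valK.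
have eW' : mx_of (adjm W) = P.
  by apply/matrixP => i j; rewrite !mxE /adjm /W conjcK !enum_valK.
have eD : mx_of (diagm d) = diag_mx D.
  apply/matrixP => i j; rewrite !mxE /diagm (inj_eq enum_val_inj) /d enum_valK.
  by rewrite RRe_real ?mulr_natr.
exists W.
  by apply: mx_of_inj; rewrite mx_of_mulm eW eW' mx_of_idm (unitarymxP hP).
by exists d; apply: mx_of_inj; rewrite /sandw !mx_of_mulm eW eW' eD.
Qed.

End Hermitian.

Section TraceNorm.
Variable R : realType.
Local Notation mat := (mat R).
Implicit Types T : finType.

(* Numerical radius at most one: this is all the trace norm duality needs,
   and unlike unitarity it passes to the adjoint of a channel. *)
Definition numradius_le1 T (M : mat T T) := forall w, normc (qform M w) <= sqnorm w.

Lemma unitary_numradius_le1 T (U : mat T T) : unitary U -> numradius_le1 U.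
Proof.
move=> hU w; rewrite qformE (le_trans (normc_sum _ _ _))//.
apply: (@le_trans _ _ (\sum_i (normc (w i) ^+ 2 + normc (mulmv U w i) ^+ 2) / 2)).
  apply: ler_sum => i _; rewrite Normc.normcM normc_conjc.
  by have := sqr_ge0 (normc (w i) - normc (mulmv U w i)); lra.
by rewrite -mulr_suml big_split /= -!/(sqnorm _) sqnorm_isometric//; lra.
Qed.

Lemma normc_trm_le_sum_eigenvalues T (M W : mat T T) (d : T -> R) :
  numradius_le1 M -> unitary W ->
  normc (trm (mulm M (sandw W (diagm d)))) <= \sum_k `|d k|.
Proof.
move=> hM hW; rewrite trm_sandw trm_mulm_diagm (le_trans (normc_sum _ _ _))//.
apply: ler_sum => k _; rewrite sandw_adjm_diag Normc.normcM normc_real ler_piMr//.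
by rewrite (le_trans (hM _))// (isometric_col _ hW).
Qed.

Lemma tnorm_sandw_diagm T (W : mat T T) (d : T -> R) : unitary W ->
  tnorm (sandw W (diagm d)) = \sum_k `|d k|.
Proof.
move=> hW; set X := sandw W _; pose s k : R := (-1) ^+ (d k < 0)%R.
have hU : unitary (sandw W (diagm s)).
  rewrite /unitary adjm_sandw herm_diagm mulm_sandw// mulm_diagm.
  have -> : (fun k => s k * s k) = fun=> 1 by apply/funext => k; rewrite -expr2 sqrr_sign.
  by rewrite diagm1 /sandw mulm1; exact: mulm1C.
have ub : ubound [set normc (trm (mulm U X)) | U in unitary] (\sum_k `|d k|).
  by move=> _ [U /unitary_numradius_le1 hM <-]; exact: normc_trm_le_sum_eigenvalues.
have attained : [set normc (trm (mulm U X)) | U in unitary] (\sum_k `|d k|).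
  exists (sandw W (diagm s)) => //.
  rewrite mulm_sandw// trm_sandw_isometric// mulm_diagm trm_diagm normc_real.
  by under eq_bigr do rewrite -normrEsign; rewrite ger0_norm ?sumr_ge0.
apply/eqP; rewrite eq_le ge_sup ?ub_le_sup//; first by exists (\sum_k `|d k|).
by exists (\sum_k `|d k|).
Qed.

Lemma le_tnorm T (X M : mat T T) : herm X -> numradius_le1 M ->
  normc (trm (mulm M X)) <= tnorm X.
Proof.
move=> /herm_spectral[W hW [d ->]] hM; rewrite tnorm_sandw_diagm//.
exact: normc_trm_le_sum_eigenvalues.
Qed.

Lemma tnorm_le T (X : mat T T) c :
  (forall U, unitary U -> normc (trm (mulm U X)) <= c) -> tnorm X <= c.
Proof.
move=> h; apply: ge_sup; last by move=> _ [U hU <-]; exact: h.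
by exists (normc (trm (mulm (idm T) X))), (idm T) => //; exact: isometric1.
Qed.

Lemma tnorm_ge0 T (X : mat T T) : herm X -> 0 <= tnorm X.
Proof. by move=> /herm_spectral[W hW [d ->]]; rewrite tnorm_sandw_diagm// sumr_ge0. Qed.

Lemma tnorm_subm_triangle T (X Y Z : mat T T) : herm X -> herm Y -> herm Z ->
  tnorm (subm X Z) <= tnorm (subm X Y) + tnorm (subm Y Z).
Proof.
move=> hX hY hZ; apply: tnorm_le => U /unitary_numradius_le1 hU.
have -> : trm (mulm U (subm X Z)) = trm (mulm U (subm X Y)) + trm (mulm U (subm Y Z)).
  by rewrite !mulm_subr !trm_subm; ring.
by rewrite (le_trans (le_normcD _ _))// lerD// le_tnorm//; exact: herm_subm.
Qed.

Lemma tnorm_subm_refl T (X : mat T T) : tnorm (subm X X) = 0.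
Proof.
have XX0 : subm X X = sandw (idm T) (diagm (fun=> 0)).
  by rewrite sandw1; apply: matP => i j; rewrite /subm /diagm subrr mul0r.
by rewrite XX0 tnorm_sandw_diagm ?big1// => [k _|]; [exact: normr0|exact: isometric1].
Qed.

End TraceNorm.

Section Positive.
Variable R : realType.
Local Notation C := R[i].
Local Notation mat := (mat R).
Implicit Types T U I : finType.

Lemma psd_summ_ketbra I T (phi : I -> T -> C) : psd (summ (fun k => ketbra (phi k))).
Proof.
move=> w; rewrite -/(qform _ w) qform_summ; apply: sumr_ge0 => k _.
by rewrite qform_ketbra ler0c sqr_ge0.
Qed.

Lemma psd_ketbra T (w : T -> C) : psd (ketbra w).
Proof. by move=> v; rewrite -/(qform _ v) qform_ketbra ler0c sqr_ge0. Qed.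

Lemma state_ketbra T (w : T -> C) : sqnorm w = 1 -> is_state (ketbra w).
Proof. by move=> w1; split; [exact: psd_ketbra|rewrite trm_ketbra w1]. Qed.

Lemma psd_sandw T U (K : mat T U) X : psd X -> psd (sandw K X).
Proof. by move=> pX w; rewrite -/(qform _ w) qform_sandw; exact: pX. Qed.

Lemma psd_diag_ge0 T (X : mat T T) t : psd X -> 0 <= Re (X t t).
Proof. by move=> /(_ (basis_vec t)); rewrite -/(qform _ _) qform_basis lecE => /andP[]. Qed.

Lemma qform_psd_real T (X : mat T T) w : psd X -> conjc (qform X w) = qform X w.
Proof. by move=> pX; rewrite -[qform X w]RRe_real ?conjc_real//; exact/ger0_real/pX. Qed.

End Positive.

Section Polarisation.
Variable R : realType.
Local Notation C := R[i].
Local Notation mat := (mat R).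
Implicit Types T : finType.

Lemma qform_addZ T (X : mat T T) (c : C) (u v : T -> C) :
  qform X (fun a => u a + c * v a) = qform X u + c * braket u (mulmv X v)
    + conjc c * braket v (mulmv X u) + conjc c * c * qform X v.
Proof.
rewrite !qformE /braket !mulr_sumr -!big_split; apply: eq_bigr => i _.
rewrite /= /mulmv !mulr_sumr -!big_split; apply: eq_bigr => j _.
by rewrite rmorphD /= conjcM; ring.
Qed.

Lemma conjc_iX s : conjc ('i%R ^+ s) = (- 'i%R) ^+ s :> C.
Proof. by rewrite -conjCi; exact: rmorphXn. Qed.

(* The phases [i ^ s] isolate one of the two cross terms. *)
Lemma polarisation T (X : mat T T) (u v : T -> C) :
  \sum_(s < 4) 'i ^+ s * qform X (fun a => u a + 'i ^+ s * v a) = 4 * braket v (mulmv X u).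
Proof.
under eq_bigr => s _ do rewrite qform_addZ conjc_iX.
move: (qform X u) (braket u _) (braket v _) (qform X v) => a b c d.
move: 'i%R (@mulCii C) => z zz; rewrite !big_ord_recr big_ord0 /= !(exprS, expr0).
transitivity (a * (1 + z + z * z + z * z * z)
  + b * (1 + z * z + (z * z) * (z * z) + (z * z) * (z * z) * (z * z))
  + c * (1 - z * z + (z * z) * (z * z) - (z * z) * (z * z) * (z * z))
  + d * (1 - z * z * z + (z * z) * (z * z) * (z * z)
         - (z * z) * (z * z) * (z * z) * (z * z) * z)); first by ring.
by rewrite !zz; ring.
Qed.

Lemma sum_phases (p q p' q' : C) :
  \sum_(s < 4) (p + 'i ^+ s * q) * (p' + conjc ('i ^+ s) * q') = 4 * (p * p' + q * q').
Proof.
under eq_bigr do rewrite conjc_iX.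
move: 'i%R (@mulCii C) => z zz; rewrite !big_ord_recr big_ord0 /= !(exprS, expr0).
transitivity (p * p' * 4 + q * q' * (1 - z * z + z * z * (z * z) - z * z * (z * z) * (z * z))
  + (p * q') * (1 - z + z * z - z * z * z) + q * p' * (1 + z + z * z + z * z * z)).
  by ring.
by rewrite !zz; ring.
Qed.

Definition polar_vec T (x : polar_index T) : T -> C :=
  fun a => basis_vec x.1.1 a + 'i ^+ x.2 * basis_vec x.1.2 a.

Lemma qform_polar_eq0 T (X : mat T T) :
  (forall x, qform X (polar_vec x) = 0) -> forall i j, X i j = 0.
Proof.
move=> X0 i j; apply: (@mulfI _ (4 : C)); first by rewrite pnatr_eq0.
rewrite mulr0 -[X i j](_ : braket (basis_vec i) (mulmv X (basis_vec j)) = _); last first.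
  rewrite mulmv_basis /braket -(sum_delta i (X ^~ j)).
  by apply: eq_bigr => k _; rewrite conjc_nat eq_sym.
by rewrite -polarisation big1// => s _; rewrite (X0 (j, i, s)) mulr0.
Qed.

Lemma qform_polar_pvec_eq0 (A B : finType) (X : bop R A B) :
  (forall x y, qform X (pvec (polar_vec x) (polar_vec y)) = 0) -> forall i j, X i j = 0.
Proof.
move=> X0 [a b] [a' b'].
pose Bob_form (u : B -> C) : mat A A := fun i j =>
  qform (fun k l => X (i, k) (j, l)) u.
suff Bob0 y : forall i j, Bob_form (polar_vec y) i j = 0.
  exact: (@qform_polar_eq0 B (fun k l => X (a, k) (a', l)) (fun y => Bob0 y a a') b b').
apply: qform_polar_eq0 => x; rewrite -[RHS](X0 x y) /qform sum_pair.
apply: eq_bigr => i _; under [RHS]eq_bigr do rewrite sum_pair.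
rewrite exchange_big; apply: eq_bigr => j _ /=.
rewrite mulr_sumr mulr_suml; apply: eq_bigr => k _.
rewrite mulr_sumr mulr_suml; apply: eq_bigr => l _.
by rewrite /pvec conjcM /=; ring.
Qed.

Lemma psd_herm T (X : mat T T) : psd X -> herm X.
Proof.
move=> pX; apply: matP => i j; apply/eqP; rewrite -subr_eq0; apply/eqP; move: i j.
by apply: qform_polar_eq0 => x; rewrite qform_subm qform_adjm qform_psd_real// subrr.
Qed.

Lemma psd_ensemble T (X : mat T T) : psd X ->
  exists phi : T -> T -> C, X = summ (fun k => ketbra (phi k)).
Proof.
move=> pX; have [W hW [d eX]] := herm_spectral (psd_herm pX).
have d_ge0 k : 0 <= d k.
  have := psd_diag_ge0 k (psd_sandw (adjm W) pX).
  by rewrite eX sandw_adjmK// /diagm eqxx mulr1.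
exists (fun k i => (Num.sqrt (d k))%:C * W i k); apply: matP => i j.
rewrite eX sandw_diagmE; apply: eq_bigr => k _.
by rewrite /ketbra conjcM conjc_real -{1}(sqr_sqrtr (d_ge0 k)) rmorphXn; ring.
Qed.

End Polarisation.

Arguments polar_vec {R T}.

(** * LOCC channels *)

Section Kraus.
Variable R : realType.
Local Notation mat := (mat R).
Implicit Types I J T U V : finType.

Lemma sum_tagged (W : nmodType) I (S : I -> finType) (F : {i : I & S i} -> W) :
  \sum_p F p = \sum_i \sum_j F (existT _ i j).
Proof.
rewrite (sig_big_dep xpredT (fun=> xpredT) (fun i j => F (existT _ i j))).
by apply: eq_bigr => -[].
Qed.

Definition krausmap I T U (K : I -> mat T U) (X : mat U U) : mat T T :=
  summ (fun k => sandw (K k) X).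

Definition norm_preserving I T U (K : I -> mat T U) :=
  forall w, \sum_k sqnorm (mulmv (K k) w) = sqnorm w.

Lemma tp_kraus_norm_preserving I T U (K : I -> mat T U) : tp_kraus K -> norm_preserving K.
Proof.
move=> hK w; apply: complexI; rewrite rmorph_sum -qform_idm /=.
under eq_bigr do rewrite sqnorm_mulmv.
by rewrite -qform_summ; congr qform; apply: matP => x y; exact: hK.
Qed.

Lemma tp_kraus_isometric T U (V : mat T U) : isometric V -> tp_kraus (fun _ : unit => V).
Proof. by move=> hV x y; rewrite sum_unit hV. Qed.

Lemma tp_kraus_kron I J (T U T' U' : finType) (K : I -> mat T U) (L : J -> mat T' U') :
  tp_kraus K -> tp_kraus L -> tp_kraus (fun p : I * J => kron (K p.1) (L p.2)).
Proof.
move=> hK hL x y; rewrite sum_pair -kron1.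
rewrite /kron -hK -hL mulr_suml; apply: eq_bigr => i _; rewrite mulr_sumr.
by apply: eq_bigr => j _; rewrite adjm_kron mulm_kron.
Qed.

Lemma tp_kraus_kronl I T U B (K : I -> mat T U) :
  tp_kraus K -> tp_kraus (fun k => kron (K k) (idm B)).
Proof.
move=> hK x y; rewrite -kron1 /kron -hK mulr_suml.
by apply: eq_bigr => i _; rewrite adjm_kron mulm_kron adjm1 mulm1.
Qed.

Lemma tp_kraus_kronr I T U A (L : I -> mat T U) :
  tp_kraus L -> tp_kraus (fun k => kron (idm A) (L k)).
Proof.
move=> hL x y; rewrite -kron1 /kron -hL mulr_sumr.
by apply: eq_bigr => i _; rewrite adjm_kron mulm_kron adjm1 mulm1.
Qed.

Lemma krausmap_subm I T U (K : I -> mat T U) X Y :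
  krausmap K (subm X Y) = subm (krausmap K X) (krausmap K Y).
Proof.
by rewrite /krausmap -summ_subm; congr summ; apply/funext => k; rewrite sandw_subm.
Qed.

Lemma krausmap_summ I J T U (K : I -> mat T U) (X : J -> mat U U) :
  krausmap K (summ X) = summ (fun j => krausmap K (X j)).
Proof.
apply: matP => x y; rewrite /krausmap; under [LHS]eq_bigr do rewrite sandw_summ.
exact: exchange_big.
Qed.

Lemma herm_krausmap I T U (K : I -> mat T U) X : herm X -> herm (krausmap K X).
Proof. by move=> hX; apply: herm_summ => k; exact: herm_sandw. Qed.

Lemma psd_krausmap I T U (K : I -> mat T U) X : psd X -> psd (krausmap K X).
Proof.
move=> pX w; rewrite -/(qform _ w) qform_summ; apply: sumr_ge0 => k _.
exact: psd_sandw.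
Qed.

Lemma tnorm_krausmap I T U (K : I -> mat T U) X :
  norm_preserving K -> herm X -> tnorm (krausmap K X) <= tnorm X.
Proof.
move=> hK hX; apply: tnorm_le => M /unitary_numradius_le1 hM.
have -> : trm (mulm M (krausmap K X)) = trm (mulm (krausmap (fun k => adjm (K k)) M) X).
  by rewrite mulm_summr mulm_summl !trm_summ; apply: eq_bigr => k _; rewrite trm_sandw.
apply: le_tnorm => // w; rewrite qform_summ (le_trans (normc_sum _ _ _))// -hK.
by apply: ler_sum => k _; rewrite qform_sandw adjmK.
Qed.

Lemma norm_preserving_adaptive I J (S : I -> finType) T U V
    (K : I -> J -> mat U V) (L : forall i, S i -> mat T U) :
  norm_preserving (fun p : I * J => K p.1 p.2) -> (forall i, norm_preserving (@L i)) ->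
  norm_preserving (fun p : {i : I & (J * S i)%type} =>
    mulm (L (tag p) (tagged p).2) (K (tag p) (tagged p).1)).
Proof.
move=> hK hL w; rewrite -hK sum_tagged [RHS]sum_pair; apply: eq_bigr => i _.
rewrite sum_pair; apply: eq_bigr => j _; rewrite -(hL i).
by apply: eq_bigr => s _; rewrite mulmv_mulm.
Qed.

Lemma krausmap_adaptive I J (S : I -> finType) T U V
    (K : I -> J -> mat U V) (L : forall i, S i -> mat T U) X :
  krausmap (fun p : {i : I & (J * S i)%type} =>
    mulm (L (tag p) (tagged p).2) (K (tag p) (tagged p).1)) X
  = summ (fun i => krausmap (@L i) (krausmap (K i) X)).
Proof.
apply: matP => x y; rewrite /krausmap /summ sum_tagged; apply: eq_bigr => i _.
rewrite sum_pair exchange_big; apply: eq_bigr => s _.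
by rewrite -/(summ _) sandw_summ; apply: eq_bigr => j _; rewrite sandw_mulm.
Qed.

End Kraus.

Section SeparableKraus.
Variable R : realType.
Local Notation mat := (mat R).
Implicit Types (A B I J : finType).

Record local_kraus A B A' B' := LocalKraus {
  outcomes : finType;
  alice_op : outcomes -> mat A' A;
  bob_op : outcomes -> mat B' B }.

Definition joint_op A B A' B' (s : local_kraus A B A' B') (o : outcomes s) :=
  kron (alice_op o) (bob_op o).

Definition separable_channel A B A' B' (Lam : bop R A B -> bop R A' B') :=
  exists s : local_kraus A B A' B',
    norm_preserving (@joint_op _ _ _ _ s) /\ Lam = krausmap (@joint_op _ _ _ _ s).

Lemma separable_channel_adaptive A B A1 B1 A' B' I J
    (K : I -> J -> mat A1 A) (L : I -> J -> mat B1 B) (Psi : I -> bop R A1 B1 -> bop R A' B') :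
  norm_preserving (fun p : I * J => kron (K p.1 p.2) (L p.1 p.2)) ->
  (forall i, separable_channel (Psi i)) ->
  separable_channel (fun X => summ (fun i =>
    Psi i (krausmap (fun j => kron (K i j) (L i j)) X))).
Proof.
move=> hKL /choice[s hs].
pose O : finType := {i : I & (J * outcomes (s i))%type}.
pose t : local_kraus A B A' B' := @LocalKraus A B A' B' O
  (fun p => mulm (alice_op (tagged p).2) (K (tag p) (tagged p).1))
  (fun p => mulm (bob_op (tagged p).2) (L (tag p) (tagged p).1)).
pose instrument i j := kron (K i j) (L i j); pose ops i := @joint_op _ _ _ _ (s i).
have jointE : @joint_op _ _ _ _ t =
    fun p : O => mulm (ops (tag p) (tagged p).2) (instrument (tag p) (tagged p).1).
  by apply/funext => p; rewrite /joint_op mulm_kron.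
exists t; rewrite jointE; split.
  apply: (@norm_preserving_adaptive _ _ _ _ _ _ _ instrument ops) => // i.
  exact: (hs i).1.
apply/funext => X; rewrite (krausmap_adaptive instrument ops); congr summ.
by apply/funext => i; rewrite (hs i).2.
Qed.

Lemma LOCC_separable_channel (A B A' B' : finType) (Lam : bop R A B -> bop R A' B') :
  LOCC Lam -> separable_channel Lam.
Proof.
elim=> {A B A' B' Lam}
  [A B A' B' I J K L hK hL|A B A1 A' B' I J K Psi hK _ IH|A B B1 A' B' I J L Psi hL _ IH].
- exists (@LocalKraus A B A' B' (I * J)%type (fun p => K p.1) (fun p => L p.2)); split.
    exact/tp_kraus_norm_preserving/tp_kraus_kron.
  apply/funext => X; apply: matP => x y; exact/esym/sum_pair.
- apply: (separable_channel_adaptive (L := fun _ _ => idm B)) IH.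
  exact/tp_kraus_norm_preserving/tp_kraus_kronl.
- apply: (separable_channel_adaptive (K := fun _ _ => idm A)) IH.
  exact/tp_kraus_norm_preserving/tp_kraus_kronr.
Qed.

Variables (A B A' B' : finType) (Lam : bop R A B -> bop R A' B').
Hypothesis LOCC_Lam : LOCC Lam.

Lemma LOCC_summ I (X : I -> bop R A B) : Lam (summ X) = summ (fun k => Lam (X k)).
Proof. by have [s [_ ->]] := LOCC_separable_channel LOCC_Lam; exact: krausmap_summ. Qed.

Lemma LOCC_subm X Y : Lam (subm X Y) = subm (Lam X) (Lam Y).
Proof. by have [s [_ ->]] := LOCC_separable_channel LOCC_Lam; exact: krausmap_subm. Qed.

Lemma LOCC_herm X : herm X -> herm (Lam X).
Proof. by have [s [_ ->]] := LOCC_separable_channel LOCC_Lam; exact: herm_krausmap. Qed.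

Lemma LOCC_psd X : psd X -> psd (Lam X).
Proof. by have [s [_ ->]] := LOCC_separable_channel LOCC_Lam; exact: psd_krausmap. Qed.

Lemma LOCC_tnorm X : herm X -> tnorm (Lam X) <= tnorm X.
Proof. by have [s [hs ->]] := LOCC_separable_channel LOCC_Lam; exact: tnorm_krausmap. Qed.

End SeparableKraus.

Section LOCCClosure.
Variable R : realType.
Local Notation mat := (mat R).
Implicit Types A B : finType.

Lemma LOCC_Alice_channel (A B A1 A' B' J : finType) (K : J -> mat A1 A)
    (Psi : bop R A1 B -> bop R A' B') :
  tp_kraus K -> LOCC Psi -> LOCC (fun X => Psi (krausmap (fun j => kron (K j) (idm B)) X)).
Proof.
move=> hK hPsi; rewrite (_ : (fun X => _) = fun X x y => \sum_(i : unit)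
  Psi (krausmap (fun j => kron (K j) (idm B)) X) x y); last first.
  by apply/funext => X; apply: matP => x y; rewrite sum_unit.
apply: (@LOCC_Alice _ _ _ _ _ _ unit J (fun=> K) (fun=> Psi)) => // x y.
by rewrite sum_pair sum_unit -hK.
Qed.

Lemma LOCC_Bob_channel (A B B1 A' B' J : finType) (L : J -> mat B1 B)
    (Psi : bop R A B1 -> bop R A' B') :
  tp_kraus L -> LOCC Psi -> LOCC (fun X => Psi (krausmap (fun j => kron (idm A) (L j)) X)).
Proof.
move=> hL hPsi; rewrite (_ : (fun X => _) = fun X x y => \sum_(i : unit)
  Psi (krausmap (fun j => kron (idm A) (L j)) X) x y); last first.
  by apply/funext => X; apply: matP => x y; rewrite sum_unit.
apply: (@LOCC_Bob _ _ _ _ _ _ unit J (fun=> L) (fun=> Psi)) => // x y.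
by rewrite sum_pair sum_unit -hL.
Qed.

Lemma LOCC_comp (A B A' B' : finType) (Lam : bop R A B -> bop R A' B') :
  LOCC Lam -> forall (A1 B1 : finType) (Lam' : bop R A' B' -> bop R A1 B1),
  LOCC Lam' -> LOCC (Lam' \o Lam).
Proof.
elim=> {A B A' B' Lam}
  [A B A' B' I J K L hK hL|A B A2 A' B' I J K Psi hK hP IH|A B B2 A' B' I J L Psi hL hP IH]
  A1 B1 Lam' hLam'.
- rewrite (_ : _ \o _ = fun X => Lam' (krausmap (fun j => kron (idm A') (L j))
    (krausmap (fun i => kron (K i) (idm B)) X))).
    exact: (LOCC_Alice_channel hK (LOCC_Bob_channel hL hLam')).
  apply/funext => X /=; congr Lam'; apply: matP => x y.
  rewrite exchange_big; apply: eq_bigr => j _; rewrite sandw_summ; apply: eq_bigr => i _.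
  by rewrite -sandw_mulm -kron_split.
- rewrite (_ : _ \o _ = fun X x y =>
    \sum_i (Lam' \o Psi i) (krausmap (fun j => kron (K i j) (idm B)) X) x y).
    by apply: (@LOCC_Alice _ _ _ _ _ _ _ _ _ (fun i => Lam' \o Psi i) hK) => i; exact: IH.
  by apply/funext => X; rewrite /= [LHS]LOCC_summ.
- rewrite (_ : _ \o _ = fun X x y =>
    \sum_i (Lam' \o Psi i) (krausmap (fun j => kron (idm A) (L i j)) X) x y).
    by apply: (@LOCC_Bob _ _ _ _ _ _ _ _ _ (fun i => Lam' \o Psi i) hL) => i; exact: IH.
  by apply/funext => X; rewrite /= [LHS]LOCC_summ.
Qed.

Lemma swapopK A B : cancel (@swapop R A B) (@swapop R B A).
Proof. by move=> X; apply: matP => -[a b] [c d]. Qed.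

Lemma swapop_sandw (A B A' B' : finType) (K : mat A' A) (L : mat B' B) X :
  swapop (sandw (kron K L) X) = sandw (kron L K) (swapop X).
Proof.
apply: matP => x y; rewrite /swapop !sandwE sum_swap; apply: eq_bigr => i _.
rewrite sum_swap; apply: eq_bigr => j _ /=.
by rewrite /kron /= [K x.2 _ * _]mulrC [K y.2 _ * _]mulrC.
Qed.

Lemma swapop_krausmap (A B A' B' I : finType) (K : I -> mat A' A) (L : I -> mat B' B) X :
  swapop (krausmap (fun i => kron (K i) (L i)) X)
  = krausmap (fun i => kron (L i) (K i)) (swapop X).
Proof.
by apply: matP => x y; apply: eq_bigr => i _; rewrite -swapop_sandw.
Qed.

Lemma LOCC_swap (A B A' B' : finType) (Lam : bop R A B -> bop R A' B') :
  LOCC Lam -> LOCC (fun X => swapop (Lam (swapop X))).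
Proof.
elim=> {A B A' B' Lam}
  [A B A' B' I J K L hK hL|A B A2 A' B' I J K Psi hK hP IH|A B B2 A' B' I J L Psi hL hP IH].
- rewrite (_ : (fun X => _) = fun X x y => \sum_j \sum_i sandw (kron (L j) (K i)) X x y).
    exact: LOCC_local.
  apply/funext => X; apply: matP => x y; rewrite exchange_big.
  by do 2 apply: eq_bigr => ? _; rewrite -[X in RHS]swapopK -[in RHS]swapop_sandw.
- rewrite (_ : (fun X => _) = fun X x y => \sum_i
    swapop (Psi i (swapop (krausmap (fun j => kron (idm B) (K i j)) X))) x y).
    exact: (@LOCC_Bob _ _ _ _ _ _ _ _ _ (fun i Y => swapop (Psi i (swapop Y))) hK).
  by apply/funext => X; apply: matP => x y; apply: eq_bigr => i _; rewrite swapop_krausmap.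
- rewrite (_ : (fun X => _) = fun X x y => \sum_i
    swapop (Psi i (swapop (krausmap (fun j => kron (L i j) (idm A)) X))) x y).
    exact: (@LOCC_Alice _ _ _ _ _ _ _ _ _ (fun i Y => swapop (Psi i (swapop Y))) hL).
  by apply/funext => X; apply: matP => x y; apply: eq_bigr => i _; rewrite swapop_krausmap.
Qed.

Lemma herm_swapop A B (X : bop R A B) : herm X -> herm (swapop X).
Proof. by move=> hX; rewrite /herm -{2}hX. Qed.

Lemma trm_swapop A B (X : bop R A B) : trm (swapop X) = trm X.
Proof. exact/esym/sum_swap. Qed.

Lemma swapop_mulm A B (X Y : bop R A B) : swapop (mulm X Y) = mulm (swapop X) (swapop Y).
Proof. by apply: matP => x y; exact: sum_swap. Qed.

Lemma unitary_swapop A B (U : bop R A B) : unitary U -> unitary (swapop U).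
Proof.
move=> hU; rewrite /unitary; have -> : idm (B * A)%type = swapop (idm (A * B)%type) :> bop R B A.
  by apply: matP => -[b a] [b' a']; rewrite /swapop /idm !xpair_eqE andbC.
by rewrite -hU swapop_mulm.
Qed.

Lemma tnorm_swapop A B (X : bop R A B) : tnorm (swapop X) = tnorm X.
Proof.
have trE U : trm (mulm (swapop U) X) = trm (mulm U (swapop X)).
  by rewrite -[RHS]trm_swapop swapop_mulm swapopK.
congr sup; apply/seteqP; split=> _ [U hU <-]; exists (swapop U); do ?exact: unitary_swapop.
  by rewrite trE.
by rewrite -trE swapopK.
Qed.

End LOCCClosure.

(** * Transition rates *)

Section TensorPowers.
Variable R : realType.
Local Notation C := R[i].
Implicit Types A B I : finType.

Lemma tpow_swapop A B (rho : bop R A B) n : tpow (swapop rho) n = swapop (tpow rho n).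
Proof. by []. Qed.

Lemma herm_tpow A B (rho : bop R A B) n : herm rho -> herm (tpow rho n).
Proof.
move=> hrho; apply: matP => x y; rewrite /adjm rmorph_prod; apply: eq_bigr => k _.
by rewrite -{2}hrho.
Qed.

Lemma trm_tpow A B (rho : bop R A B) n : trm (tpow rho n) = trm rho ^+ n.
Proof.
rewrite /trm /tpow -(prod_sum_pair (fun (k : 'I_n) p => rho p p)).
by rewrite prodr_const card_ord.
Qed.

Lemma tpow_summ_ketbra A B I (phi : I -> A * B -> C) n :
  tpow (summ (fun i => ketbra (phi i))) n =
  summ (fun s : {ffun 'I_n -> I} =>
    ketbra (fun x : {ffun 'I_n -> A} * {ffun 'I_n -> B} => \prod_k phi (s k) (x.1 k, x.2 k))).
Proof.
apply: matP => x y; rewrite /tpow /summ bigA_distr_bigA; apply: eq_bigr => s _.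
by rewrite /ketbra big_split rmorph_prod.
Qed.

Lemma psd_tpow A B (rho : bop R A B) n : psd rho -> psd (tpow rho n).
Proof. by move=> /psd_ensemble[phi ->]; rewrite tpow_summ_ketbra; exact: psd_summ_ketbra. Qed.

Lemma state_tpow A B (rho : bop R A B) n : is_state rho -> is_state (tpow rho n).
Proof. by move=> [prho rho1]; split; [exact: psd_tpow|rewrite trm_tpow rho1 expr1n]. Qed.

End TensorPowers.

Section Discarding.
Variable R : realType.
Local Notation mat := (mat R).

Lemma card_ffun_ord0 (T : finType) : #|{ffun 'I_0 -> T}| = 1%N.
Proof. by rewrite card_ffun card_ord. Qed.

Lemma tpow_ord0 (A B : finType) (sigma : bop R A B) x y : tpow sigma 0 x y = 1.
Proof. by rewrite /tpow big_ord0. Qed.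

Definition discard (T U : finType) (t : T) : mat U T := fun _ => idm T t.

Lemma tp_kraus_discard (T U : finType) : #|U| = 1%N -> tp_kraus (@discard T U).
Proof.
move=> U1 x y; rewrite -[idm T in RHS](@isometric1 R T).
by apply: eq_bigr => t _; rewrite /mulm /adjm /discard sumr_const U1.
Qed.

Lemma sum_discard (A B A' B' : finType) (X : bop R A B) (x y : A' * B') :
  \sum_a \sum_b sandw (kron (discard a) (discard b)) X x y = trm X.
Proof.
rewrite /trm sum_pair; apply: eq_bigr => a _; apply: eq_bigr => b _.
by rewrite -[X in RHS]sandw1 -kron1.
Qed.

End Discarding.

Section AchievableRates.
Variable R : realType.

Lemma achievable0 (A B A' B' : finType) (rho : bop R A B) (sigma : bop R A' B') :
  trm rho = 1 -> achievable rho sigma 0.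
Proof.
move=> rho1; split => //; exists (fun=> 0%N), (fun n X x y =>
  \sum_a \sum_b sandw (kron (discard _ a) (discard _ b)) X x y).
split => [n|]; first by apply: LOCC_local; apply: tp_kraus_discard; exact: card_ffun_ord0.
split; first by under eq_fun do rewrite mul0r; exact: cvg_cst.
under eq_fun => n.
  rewrite (_ : (fun x y => _) = tpow sigma 0) ?tnorm_subm_refl; last first.
    by apply: matP => x y; rewrite sum_discard trm_tpow rho1 expr1n tpow_ord0.
  over.
exact: cvg_cst.
Qed.

Lemma cvg_ratio_infty (m : nat -> nat) (r : R) : 0 < r ->
  (fun n => (m n)%:R / n%:R : R) @ \oo --> r -> m @ \oo --> \oo.
Proof.
move=> r0 hm; apply/cvgnyPge => N; near=> n; rewrite -(ler_nat R).
have n0 : (0 : R) < n%:R by rewrite ltr0n; near: n; exact: nbhs_infty_gt.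
have mn : r / 2 < (m n)%:R / n%:R by near: n; apply: (cvgr_gt _ hm); lra.
have Nn : N%:R / (r / 2) <= n%:R by near: n; exact: nbhs_infty_ger.
rewrite ltr_pdivlMr// in mn; rewrite ler_pdivrMr ?divr_gt0// in Nn.
by rewrite (le_trans Nn)// mulrC ltW.
Unshelve. all: by end_near. Qed.

Lemma achievable_trans (A B A' B' A2 B2 : finType) (rho : bop R A B)
    (sigma : bop R A' B') (tau : bop R A2 B2) r1 r2 :
  trm rho = 1 -> herm rho -> herm sigma -> herm tau ->
  achievable rho sigma r1 -> achievable sigma tau r2 -> achievable rho tau (r1 * r2).
Proof.
move=> rho1 hrho hsigma htau [r1_ge0 [m1 [L1 [locc1 [m1r to_sigma]]]]].
move=> [r2_ge0 [m2 [L2 [locc2 [m2r to_tau]]]]].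
have [->|r1_neq0] := eqVneq r1 0; first by rewrite mul0r; exact: achievable0.
have r1_gt0 : 0 < r1 by rewrite lt_neqAle eq_sym r1_neq0.
have m1oo := cvg_ratio_infty r1_gt0 m1r.
split; first exact: mulr_ge0.
exists (m2 \o m1), (fun n => L2 (m1 n) \o L1 n); split => [n|]; first exact: LOCC_comp.
split.
  apply: cvg_trans (cvgM m1r (cvg_comp _ _ m1oo m2r)); apply: near_eq_cvg.
  have /cvgnyPge/(_ 1%N) := m1oo; apply: filterS => n m1_gt0 /=.
  by rewrite mulrC mulrA divfK// pnatr_eq0 -lt0n.
pose err1 n := tnorm (subm (L1 n (tpow rho n)) (tpow sigma (m1 n))).
pose err2 n := tnorm (subm (L2 n (tpow sigma n)) (tpow tau (m2 n))).
have err0 : (fun n => err1 n + err2 (m1 n)) @ \oo --> (0 : R).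
  by rewrite -[0](addr0 0); apply: cvgD => //; exact: (cvg_comp _ _ m1oo to_tau).
apply: (squeeze_cvgr _ (cvg_cst 0) err0); apply: nearW => n /=.
have hL1 : herm (L1 n (tpow rho n)) by exact/LOCC_herm/herm_tpow.
have hL2 X : herm X -> herm (L2 (m1 n) X) by exact: LOCC_herm.
rewrite tnorm_ge0; last by apply: herm_subm; [exact: hL2|exact: herm_tpow].
rewrite (le_trans (tnorm_subm_triangle (hL2 _ hL1) (hL2 _ (herm_tpow _ hsigma))
  (herm_tpow _ htau)))// lerD2r -LOCC_subm// LOCC_tnorm//.
by apply: herm_subm => //; exact: herm_tpow.
Qed.

Lemma achievable_swapop (A B A' B' : finType) (rho : bop R A B) (sigma : bop R A' B') r :
  achievable rho sigma r -> achievable (swapop rho) (swapop sigma) r.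
Proof.
move=> [r0 [m [L [locc [mr err0]]]]]; split => //.
exists m, (fun n X => swapop (L n (swapop X))); split => [n|]; first exact: LOCC_swap.
split => //; under eq_fun do
  rewrite !tpow_swapop swapopK -[subm _ _]/(swapop (subm _ _)) tnorm_swapop.
exact: err0.
Qed.

End AchievableRates.

Section Rates.
Local Open Scope ereal_scope.
Variable R : realType.

Lemma mule_ereal_sup_le (x c : \bar R) (S : set (\bar R)) : 0 <= x -> S 0 ->
  (forall y, S y -> x * y <= c) -> x * ereal_sup S <= c.
Proof.
move=> x0 S0 hc; have c0 : 0 <= c by have := hc _ S0; rewrite mule0.
case: x x0 hc => [r| |] // r0 hc.
  rewrite -ereal_supZl//; last by apply/set0P; exists 0.
  by apply: ge_ereal_sup => _ [y Sy <-]; exact: hc.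
have [S_gt0|S_le0] := ltP 0 (ereal_sup S); last first.
  suff -> : ereal_sup S = 0 by rewrite mule0.
  by apply/eqP; rewrite eq_le S_le0 ereal_sup_ubound.
have [y Sy y0] := ereal_sup_gt S_gt0.
by have := hc _ Sy; rewrite gt0_mulye// leye_eq => /eqP ->; rewrite leey.
Qed.

Lemma rate_ge0 (A B A' B' : finType) (rho : bop R A B) (sigma : bop R A' B') :
  trm rho = 1%R -> 0 <= rate rho sigma.
Proof. by move=> rho1; apply: ereal_sup_ubound; exists 0%R => //; exact: achievable0. Qed.

Lemma rate_trans (A B A' B' A2 B2 : finType) (rho : bop R A B)
    (sigma : bop R A' B') (tau : bop R A2 B2) :
  trm rho = 1%R -> trm sigma = 1%R -> herm rho -> herm sigma -> herm tau ->
  rate rho sigma * rate sigma tau <= rate rho tau.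
Proof.
move=> rho1 sigma1 hrho hsigma htau; apply: mule_ereal_sup_le; first exact: rate_ge0.
  by exists 0%R => //; exact: achievable0.
move=> _ [s hs <-]; rewrite muleC; apply: mule_ereal_sup_le; first by case: hs.
  by exists 0%R => //; exact: achievable0.
move=> _ [r hr <-]; apply: ereal_sup_ubound; exists (r * s)%R; last by rewrite muleC.
exact: achievable_trans hr hs.
Qed.

Lemma rate_swapop (A B A' B' : finType) (rho : bop R A B) (sigma : bop R A' B') :
  rate (swapop rho) (swapop sigma) = rate rho sigma.
Proof.
congr ereal_sup; apply/seteqP; split=> _ [r hr <-]; exists r => //.
  by rewrite -[rho]swapopK -[sigma]swapopK; exact: achievable_swapop.
exact: achievable_swapop.
Qed.

Lemma rate_le_natr (A B A' B' : finType) (rho : bop R A B) (sigma : bop R A' B')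
    (l : nat) (e : R) : (0 < e)%R ->
  (\forall n \near \oo, forall m (Lam : copies R A B n -> copies R A' B' m),
     (l * n <= m)%N -> LOCC Lam ->
     (e <= tnorm (subm (Lam (tpow rho n)) (tpow sigma m)))%R) ->
  rate rho sigma <= l%:R%:E.
Proof.
move=> e0 far; apply: ge_ereal_sup => _ [r [_ [m [Lam [locc [mr err0]]]]] <-].
rewrite lee_fin leNgt; apply/negP => lr.
suff : \forall n \near \oo, False by case=> N _ /(_ N (leqnn N)).
near=> n.
have n0 : (0 < n)%N by near: n; exact: nbhs_infty_gt.
have lmn : (l%:R < (m n)%:R / n%:R :> R)%R by near: n; exact: (cvgr_gt _ mr).
have mn : (l * n <= m n)%N.
  by move: lmn; rewrite ltr_pdivlMr ?ltr0n// -natrM ltr_nat => /ltnW.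
have : (tnorm (subm (Lam n (tpow rho n)) (tpow sigma (m n))) < e)%R.
  by near: n; exact: (cvgr_lt _ err0).
rewrite ltNge => /negP; apply; move: mn (locc n); move: (Lam n).
by move: (m n); near: n.
Unshelve. all: by end_near. Qed.

End Rates.

(** * Teleportation *)

Section MaximallyEntangled.
Variable R : realType.
Local Notation C := R[i].
Local Notation mat := (mat R).
Implicit Types T : finType.

Definition maxent T : bop R T T := fun x y =>
  #|T|%:R^-1 * ((x.1 == x.2)%:R * (y.1 == y.2)%:R).
Arguments maxent : clear implicits.

Lemma psi_plus_maxent : psi_plus = maxent 'I_2.
Proof.
apply: matP => x y; rewrite /psi_plus /maxent card_ord -natrM mulnb.
by case: ifP => _; rewrite ?mulr1 ?mulr0.
Qed.

Lemma swapop_maxent T : swapop (maxent T) = maxent T.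
Proof. by apply: matP => x y; rewrite /swapop /maxent eq_sym [y.2 == _]eq_sym. Qed.

Lemma maxent_ketbra T : maxent T =
  ketbra (fun x => (Num.sqrt #|T|%:R^-1 : R)%:C * (x.1 == x.2)%:R).
Proof.
apply: matP => x y; rewrite /maxent /ketbra conjcM conjc_real conjc_nat mulrACA.
by rewrite sqr_sqrt_invn.
Qed.

Lemma psd_maxent T : psd (maxent T).
Proof. by rewrite maxent_ketbra; exact: psd_ketbra. Qed.

Lemma trm_maxent T : (0 < #|T|)%N -> trm (maxent T) = 1.
Proof.
move=> T0; rewrite /trm sum_pair.
rewrite (eq_bigr (fun=> #|T|%:R^-1)) => [|t _].
  by rewrite sumr_const -[LHS]mulr_natr mulVf// pnatr_eq0 -lt0n.
rewrite -[RHS](sum_delta t (fun=> _)); apply: eq_bigr => u _.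
by rewrite /maxent /= -natrM mulnb andbb mulrC.
Qed.

Lemma tpow_maxent T n : tpow (maxent T) n = maxent {ffun 'I_n -> T}.
Proof.
apply: matP => x y; rewrite /tpow /maxent !big_split /= !prod_delta prodr_const card_ord.
by rewrite card_ffun card_ord natrX exprVn.
Qed.

Lemma sandw_kron_maxent T (A B : finType) (K : mat A T) (L : mat B T) x y :
  sandw (kron K L) (maxent T) x y =
  #|T|%:R^-1 * ketbra (fun x => \sum_z K x.1 z * L x.2 z) x y.
Proof.
have diag_sum (F : T * T -> C) : \sum_p (p.1 == p.2)%:R * F p = \sum_z F (z, z).
  by rewrite sum_pair; apply: eq_bigr => z _; exact: sum_delta.
rewrite sandwE /ketbra -!(diag_sum (fun p => K _ p.1 * L _ p.2)) rmorph_sum mulr_suml mulr_sumr.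
apply: eq_bigr => p _; rewrite !mulr_sumr; apply: eq_bigr => q _.
by rewrite /maxent /kron /= !conjcM conjc_nat; ring.
Qed.

Lemma tpow_psi_plus n : tpow psi_plus n = maxent {ffun 'I_n -> 'I_2}.
Proof. by rewrite psi_plus_maxent tpow_maxent. Qed.

Lemma swapop_psi_plus : swapop (@psi_plus R) = psi_plus.
Proof. by rewrite psi_plus_maxent swapop_maxent. Qed.

Lemma state_psi_plus : is_state (@psi_plus R).
Proof.
by rewrite psi_plus_maxent; split; [exact: psd_maxent|rewrite trm_maxent// card_ord].
Qed.

End MaximallyEntangled.
Arguments maxent {R} T.

Section TensorProducts.
Variable R : realType.
Local Notation mat := (mat R).
Implicit Types T U V : finType.
Variable n : nat.

Definition tensm T U (X : 'I_n -> mat T U) : mat {ffun 'I_n -> T} {ffun 'I_n -> U} :=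
  fun x y => \prod_k X k (x k) (y k).

Lemma mulm_tensm T U V (X : 'I_n -> mat T U) (Y : 'I_n -> mat U V) :
  mulm (tensm X) (tensm Y) = tensm (fun k => mulm (X k) (Y k)).
Proof.
apply: matP => x y; rewrite /mulm /tensm bigA_distr_bigA.
by apply: eq_bigr => z _; rewrite big_split.
Qed.

Lemma adjm_tensm T U (X : 'I_n -> mat T U) : adjm (tensm X) = tensm (fun k => adjm (X k)).
Proof. by apply: matP => x y; exact: rmorph_prod. Qed.

Lemma tensm1 T : tensm (fun=> idm T) = idm {ffun 'I_n -> T}.
Proof. by apply: matP => x y; exact: prod_delta. Qed.

Lemma isometric_tensm T U (X : 'I_n -> mat T U) :
  (forall k, isometric (X k)) -> isometric (tensm X).
Proof.
move=> hX; rewrite /isometric adjm_tensm mulm_tensm -tensm1; congr tensm.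
by apply/funext => k; exact: hX.
Qed.

Definition powm T U (X : mat T U) := tensm (fun=> X).

Lemma isometric_powm T U (X : mat T U) : isometric X -> isometric (powm X).
Proof. by move=> hX; apply: isometric_tensm. Qed.

End TensorProducts.
Arguments powm {R} n {T U}.

Section ErrorBases.
Variable R : realType.
Local Notation mat := (mat R).
Implicit Types Q T : finType.

Definition error_basis Q T (U : Q -> mat T T) :=
  [/\ #|Q| = (#|T| ^ 2)%N, forall q, unitary (U q) &
      forall y y' z z',
        \sum_q conjc (U q y z) * U q y' z' = #|T|%:R * ((y == y') && (z == z'))%:R].

Lemma error_basis_twirl Q T (U : Q -> mat T T) (N : mat T T) z z' : error_basis U ->
  krausmap (fun q => adjm (U q)) N z z' = #|T|%:R * trm N * idm T z z'.
Proof.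
move=> [_ _ twirl]; rewrite /krausmap /summ.
transitivity (\sum_y \sum_y' N y y' * \sum_q conjc (U q y z) * U q y' z').
  under [RHS]eq_bigr do under eq_bigr do rewrite mulr_sumr.
  under [RHS]eq_bigr do rewrite exchange_big.
  rewrite [RHS]exchange_big; apply: eq_bigr => q _ /=; rewrite sandwE.
  by apply: eq_bigr => y _; apply: eq_bigr => y' _; rewrite /adjm conjcK; ring.
rewrite /trm mulr_sumr mulr_suml; apply: eq_bigr => y _.
rewrite -(sum_delta y (fun y' => #|T|%:R * N y y' * idm T z z')); apply: eq_bigr => y' _.
by rewrite twirl -mulnb natrM /idm; ring.
Qed.

Lemma error_basis_tensor n Q T (U : Q -> mat T T) : error_basis U ->
  error_basis (fun q : {ffun 'I_n -> Q} => tensm (fun k => U (q k))).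
Proof.
move=> [cardQ unitaryU twirl]; split => [|q|y y' z z'].
- by rewrite !card_ffun cardQ -!expnM mulnC.
- by apply: isometric_tensm => k; exact: unitaryU.
transitivity (\prod_k \sum_q conjc (U q (y k) (z k)) * U q (y' k) (z' k)).
  rewrite bigA_distr_bigA; apply: eq_bigr => q _.
  by rewrite big_split; congr (_ * _); exact: rmorph_prod.
under eq_bigr do rewrite twirl -mulnb natrM.
by rewrite !big_split /= !prod_delta prodr_const card_ord card_ffun card_ord natrX -natrM mulnb.
Qed.

Definition pauli (q : 'I_2 * 'I_2) : mat 'I_2 'I_2 :=
  fun y z => (y == q.1 + z)%:R * (if (q.2 == 1) && (z == 1) then - 1 else 1).

Lemma conjc_pauli q y z : conjc (pauli q y z) = pauli q y z.
Proof.
rewrite /pauli conjcM conjc_nat; case: ifP => _; last by rewrite conjc1.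
by congr (_ * _); exact: rmorphN1.
Qed.

Lemma error_basis_pauli : error_basis pauli.
Proof.
split => [|q|y y' z z']; first by rewrite card_prod !card_ord.
- apply: matP => z z'; rewrite /mulm /adjm; under eq_bigr do rewrite conjc_pauli.
  rewrite /pauli /idm !big_ord_recl big_ord0.
  by case: q => [[[|[|//]] ?] [[|[|//]] ?]]; case: z => [[|[|//]] ?];
    case: z' => [[|[|//]] ?] /=; ring.
- under eq_bigr do rewrite conjc_pauli.
  rewrite sum_pair !big_ord_recl !big_ord0 /pauli card_ord.
  by case: y => [[|[|//]] ?]; case: y' => [[|[|//]] ?]; case: z => [[|[|//]] ?];
    case: z' => [[|[|//]] ?] /=; ring.
Qed.

End ErrorBases.

Section Teleportation.
Variable R : realType.
Local Notation C := R[i].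
Local Notation mat := (mat R).
Implicit Types Q T A B : finType.

Definition conjm (T U : finType) (X : mat T U) : mat T U := fun i j => conjc (X i j).

Lemma unitary_conjm T (U : mat T T) : unitary U -> unitary (conjm U).
Proof.
move=> hU; apply: matP => i j; have := congr1 (fun X => conjc (X i j)) hU.
rewrite /= [X in _ = X](_ : _ = idm T i j) ?/idm ?conjc_nat// => <-; rewrite rmorph_sum.
by apply: eq_bigr => k _; rewrite [RHS]conjcM.
Qed.

Lemma LOCC_one_way (A B A' B' Q S : finType) (K : Q -> S -> mat A' A) (L : Q -> mat B' B) :
  tp_kraus (fun p : Q * S => K p.1 p.2) -> (forall q, isometric (L q)) ->
  LOCC (krausmap (fun p : Q * S => kron (K p.1 p.2) (L p.1))).
Proof.
move=> hK hL; rewrite (_ : krausmap _ = fun X x y => \sum_q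
    (fun Y x y => \sum_(i : unit) \sum_(j : unit) sandw (kron (idm A') (L q)) Y x y)
    (krausmap (fun s => kron (K q s) (idm B)) X) x y).
  apply: (@LOCC_Alice _ _ _ _ _ _ _ _ _ (fun q Y x y =>
    \sum_(i : unit) \sum_(j : unit) sandw (kron (idm A') (L q)) Y x y) hK) => q.
  by apply: LOCC_local; apply: tp_kraus_isometric => //; exact: isometric1.
apply/funext => X; apply: matP => x y; rewrite [LHS]sum_pair; apply: eq_bigr => q _.
rewrite !sum_unit sandw_summ; apply: eq_bigr => s _.
by rewrite -sandw_mulm -kron_split.
Qed.

(* Alice's outcome [q] projects the input system and her half of the resource
   on the maximally entangled vector rotated by [U q]; Bob undoes [U q]. *)
Lemma teleportation (Q T A' : finType) (U : Q -> mat T T) (omega : bop R A' T) :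
  error_basis U -> is_state omega ->
  exists2 Lam : bop R T T -> bop R A' T, LOCC Lam & Lam (maxent T) = omega.
Proof.
move=> basisU [/psd_ensemble[phi eomega] omega1].
have [cardQ unitaryU _] := basisU.
have [[_ t]] := trm1_inhabited omega1.
have T0 : #|T|%:R != 0 :> C by rewrite pnatr_eq0 -lt0n; apply/card_gt0P; exists t.
pose c : C := (Num.sqrt #|T|%:R^-1)%:C.
have cc : c * conjc c = #|T|%:R^-1 by rewrite conjc_real sqr_sqrt_invn.
pose Psi s : mat A' T := fun a b => c * phi s (a, b).
have PsiE s x y : ketbra (fun x => Psi s x.1 x.2) x y = #|T|%:R^-1 * ketbra (phi s) x y.
  case: x y => [a b] [a' b']; rewrite /ketbra /Psi conjcM -cc; ring.
pose N : mat T T := summ (fun s => mulm (adjm (Psi s)) (Psi s)).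
have trN : #|T|%:R * trm N = 1.
  rewrite trm_summ mulr_sumr -[RHS]omega1 eomega trm_summ; apply: eq_bigr => s _.
  rewrite -[RHS](mulVKf T0); congr (_ * _); rewrite /trm mulr_sumr sum_pair exchange_big.
  apply: eq_bigr => a _; apply: eq_bigr => b _.
  by rewrite -PsiE /ketbra mulrC.
exists (krausmap (fun p => kron (mulm (Psi p.2) (U p.1)) (conjm (U p.1)))).
  apply: (@LOCC_one_way _ _ _ _ _ _ (fun q s => mulm (Psi s) (U q)) (fun q => conjm (U q))).
    move=> z z'; rewrite sum_pair -[RHS]mul1r -trN -(error_basis_twirl N z z' basisU).
    apply: eq_bigr => q _; rewrite sandw_summ; apply: eq_bigr => s _.
    by rewrite /sandw adjmK adjm_mulm !mulmA.
  by move=> q; exact/unitary_conjm/unitaryU.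
apply: matP => x y; rewrite eomega [LHS]sum_pair.
transitivity (\sum_(q : Q) #|T|%:R^-1 * (#|T|%:R^-1 * summ (fun s => ketbra (phi s)) x y)).
  apply: eq_bigr => q _; rewrite !mulr_sumr; apply: eq_bigr => s _.
  rewrite sandw_kron_maxent -[in RHS]PsiE; congr (_ * ketbra _ x y).
  by apply/funext => p; rewrite -[in RHS](mulm1 (Psi s)) -(mulm1C (unitaryU q)) mulmA.
by rewrite sumr_const cardQ -[LHS]mulr_natl natrX; field.
Qed.

Lemma isometric_graph (T U : finType) (f : U -> T) : injective f ->
  isometric (fun t u => (t == f u)%:R : C).
Proof.
move=> finj; apply: matP => u u'; rewrite /mulm /adjm /idm -(inj_eq finj).
rewrite -[RHS](sum_delta (f u) (fun t => (t == f u')%:R)).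
by apply: eq_bigr => t _; rewrite conjc_nat eq_sym.
Qed.

(* Off the range of [V] the channel resets to a fixed basis state. *)
Lemma isometric_left_inverse T B (V : mat T B) (b0 : B) : isometric V ->
  exists L : unit + T -> mat B T,
    [/\ tp_kraus L, mulm (L (inl tt)) V = idm B & forall t, mulm (L (inr t)) V = fun _ _ => 0].
Proof.
move=> hV; pose P := subm (idm T) (mulm V (adjm V)).
have PV : mulm P V = fun _ _ => 0.
  rewrite mulm_subl mul1m -mulmA hV mulm1; apply: matP => i j; exact: subrr.
have PP : mulm (adjm P) P = P.
  have hP : adjm P = P by rewrite adjm_subm adjm1 adjm_mulm adjmK.
  rewrite hP {2}/P mulm_subr mulm1 mulmA PV; apply: matP => i j.
  by rewrite /subm /mulm big1 ?subr0// => k _; rewrite mul0r.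
exists (fun o => if o is inr t then fun b z => (b0 == b)%:R * P t z else adjm V).
split => // [z z'|t]; last first.
  apply: matP => b b'; have := congr1 (fun X => X t b') PV.
  by rewrite /mulm => h; under eq_bigr do rewrite -mulrA; rewrite -mulr_sumr h mulr0.
rewrite big_sumType sum_unit /= adjmK.
transitivity (mulm V (adjm V) z z' + mulm (adjm P) P z z'); last first.
  by rewrite PP /P /subm addrC subrK.
congr (_ + _); apply: eq_bigr => t _.
rewrite -(sum_delta b0 (fun b => adjm P z t * P t z')); apply: eq_bigr => b _.
by rewrite /adjm conjcM conjc_nat; case: eqP => _ /=; ring.
Qed.

Lemma LOCC_id A B : LOCC (fun X : bop R A B => X).
Proof.
rewrite (_ : (fun X => X) = fun X x y =>
  \sum_(i : unit) \sum_(j : unit) sandw (kron (idm A) (idm B)) X x y).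
  by apply: LOCC_local; apply: tp_kraus_isometric; exact: isometric1.
by apply/funext => X; apply: matP => x y; rewrite !sum_unit kron1 sandw1.
Qed.

Lemma LOCC_maxent_to_state Q T (A' B' : finType) (U : Q -> mat T T) (f : B' -> T)
    (omega : bop R A' B') : error_basis U -> injective f -> is_state omega ->
  exists2 Lam : bop R T T -> bop R A' B', LOCC Lam & Lam (maxent T) = omega.
Proof.
move=> basisU /isometric_graph; set V := (X in isometric X) => hV [pomega omega1].
have [[_ b0]] := trm1_inhabited omega1.
have hIV : isometric (kron (idm A') V) by apply: isometric_kron => //; exact: isometric1.
have [|Lam locc Lam_maxent] := @teleportation Q T A' U (sandw (kron (idm A') V) omega) basisU.
  by split; [exact: psd_sandw|rewrite trm_sandw_isometric].
have [L [tpL LV LV0]] := isometric_left_inverse b0 hV.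
exists ((fun X => krausmap (fun j => kron (idm A') (L j)) X) \o Lam).
  exact: LOCC_comp locc _ _ _ (LOCC_Bob_channel tpL (LOCC_id _ _)).
rewrite /= Lam_maxent; apply: matP => x y; rewrite /krausmap /summ.
under eq_bigr do rewrite -sandw_mulm mulm_kron mulm1.
rewrite big_sumType sum_unit /= LV kron1 sandw1 [X in _ + X]big1 ?addr0// => t _.
by rewrite LV0 sandwE !big1// => i _; rewrite big1// => j _; rewrite /kron mulr0 !mul0r.
Qed.

End Teleportation.

Section FiniteCost.
Variable R : realType.

Lemma injection_of_card (T U : finType) : (#|T| <= #|U|)%N -> exists f : T -> U, injective f.
Proof.
move=> TU; exists (fun x => enum_val (widen_ord TU (enum_rank x))) => x y.
by move=> /enum_val_inj/(congr1 val)/= /val_inj/enum_rank_inj.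
Qed.

Lemma cvg_divn (l : nat) : (0 < l)%N ->
  (fun n => (n %/ l)%:R / n%:R : R) @ \oo --> (l%:R^-1 : R).
Proof.
move=> l0.
have inv0 : (fun n => (n%:R : R)^-1) @ \oo --> (0 : R).
  apply/gtr0_cvgV0; last exact: cvgr_idn.
  by near=> n; rewrite ltr0n; near: n; exact: nbhs_infty_gt.
have lower : (fun n => l%:R^-1 - (n%:R : R)^-1) @ \oo --> (l%:R^-1 : R).
  by rewrite -[X in _ --> X]subr0; apply: cvgB => //; exact: cvg_cst.
apply: (squeeze_cvgr _ lower (cvg_cst _)).
near=> n; have n0 : (0 < n)%N by near: n; exact: nbhs_infty_gt.
have l0' : (0 : R) < l%:R by rewrite ltr0n.
have n0' : (0 : R) < n%:R by rewrite ltr0n.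
have divE : n%:R = (n %/ l)%:R * l%:R + (n %% l)%:R :> R by rewrite -natrM -natrD -divn_eq.
apply/andP; split.
  rewrite lerBlDr -[X in _ + X]mul1r -mulrDl ler_pdivlMr// mulrC ler_pdivrMr//.
  by rewrite mulrDl mul1r {1}divE lerD2l ler_nat ltnW// ltn_mod.
by rewrite ler_pdivrMr// mulrC ler_pdivlMr// {1}divE lerDl.
Unshelve. all: by end_near. Qed.

Lemma LOCC_psi_plus_to_tpow (A B : finType) (rho : bop R A B) n m :
  is_state rho -> (m * #|B| <= n)%N ->
  exists2 Lam : copies R 'I_2 'I_2 n -> copies R A B m,
    LOCC Lam & Lam (tpow psi_plus n) = tpow rho m.
Proof.
move=> st mn; have [f finj] : exists f : {ffun 'I_m -> B} -> {ffun 'I_n -> 'I_2}, injective f.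
  apply: injection_of_card; rewrite !card_ffun !card_ord.
  apply: (@leq_trans ((2 ^ #|B|) ^ m)); last by rewrite -expnM leq_exp2l// mulnC.
  by case: m {mn} => [//|k]; rewrite leq_exp2r// ltnW// ltn_expl.
have := LOCC_maxent_to_state (error_basis_tensor n (@error_basis_pauli R)) finj (state_tpow m st).
by rewrite -tpow_psi_plus.
Qed.

Lemma rate_psi_plus_gt0 (A B : finType) (rho : bop R A B) :
  is_state rho -> (0 < rate psi_plus rho)%E.
Proof.
move=> st; have [[_ b0]] := trm1_inhabited st.2.
pose l := #|B|; have l0 : (0 < l)%N by apply/card_gt0P; exists b0.
have : (0 < l%:R^-1 :> R) by rewrite invr_gt0 ltr0n.
rewrite -lte_fin => /lt_le_trans; apply; apply: ereal_sup_ubound.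
exists l%:R^-1 => //; split; first by rewrite invr_ge0.
have /(_ _)/cid2 tele n := @LOCC_psi_plus_to_tpow A B rho n (n %/ l) st (leq_divM n l).
exists (fun n => (n %/ l)%N), (fun n => s2val (tele n)).
split => [n|]; first exact: (s2valP (tele n)).
split; first exact: cvg_divn.
under eq_fun => n do rewrite (s2valP' (tele n)) tnorm_subm_refl.
exact: cvg_cst.
Qed.

End FiniteCost.

(** * Separation from the convex hull of a compact family *)

Section Caratheodory.
Variable R : realType.
Implicit Types I Z : finType.

Definition convex_weights I (c : I -> R) := (forall i, 0 <= c i) /\ \sum_i c i = 1.

Lemma affine_dependence I Z (x : I -> Z -> R) (c : I -> R) : (#|Z|.+1 < #|I|)%N ->
  exists2 d : I -> R, exists i, d i != 0 &
    \sum_i d i * c i = 0 /\ forall z, \sum_i d i * c i * x i z = 0.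
Proof.
move=> ZI; pose M : 'M[R]_(#|I|, #|{: option Z}|) :=
  \matrix_(i, j) (c (enum_val i) * oapp (x (enum_val i)) 1 (enum_val j)).
have : kermx M != 0.
  by rewrite -mxrank_eq0 mxrank_ker -lt0n subn_gt0 (leq_ltn_trans (rank_leq_col _))// card_option.
case/rowV0Pn => v /sub_kermxP vM v0.
have dep o : \sum_i v 0 (enum_rank i) * c i * oapp (x i) 1 o = 0.
  have /rowP/(_ (enum_rank o)) := vM; rewrite !mxE (reindex (@enum_rank I)) /=; last first.
    exact: onW_bij (enum_rank_bij I).
  move=> vMo; rewrite -[RHS]vMo.
  by apply: eq_bigr => i _; rewrite mxE !enum_rankK mulrA.
exists (fun i => v 0 (enum_rank i)).
  by have /rV0Pn[j vj] := v0; exists (enum_val j); rewrite enum_valK.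
by split => [|z]; [rewrite -[RHS](dep None)|rewrite -[RHS](dep (Some z))];
  apply: eq_bigr => i _; rewrite ?mulr1.
Qed.

(* Moving the weights along an affine dependence kills one of them. *)
Lemma caratheodory I Z (x : I -> Z -> R) (c : I -> R) : (#|Z|.+1 < #|I|)%N ->
  convex_weights c -> exists c' : I -> R, [/\ convex_weights c',
    forall z, \sum_i c' i * x i z = \sum_i c i * x i z & exists i, c' i = 0].
Proof.
move=> ZI [c0 c1]; have [d [i0 di0] [dc dcx]] := affine_dependence x c ZI.
pose m := [arg max_(i > i0) `|d i|]%O.
have dmax i : `|d i| <= `|d m|.
  by rewrite /m; case: arg_maxP => // j _ jmax; exact: jmax.
have dm : 0 < `|d m| by rewrite (lt_le_trans _ (dmax i0))// normr_gt0.
have shift (F : I -> R) : \sum_i d i * c i * F i = 0 ->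
    \sum_i c i * (1 - d i / d m) * F i = \sum_i c i * F i.
  move=> dcF; transitivity (\sum_i c i * F i - (d m)^-1 * \sum_i d i * c i * F i).
    by rewrite mulr_sumr -sumrB; apply: eq_bigr => i _; ring.
  by rewrite dcF mulr0 subr0.
exists (fun i => c i * (1 - d i / d m)); split.
- split => [i|].
    rewrite mulr_ge0// subr_ge0 (le_trans (ler_norm _))// normrM normfV.
    by rewrite ler_pdivrMr// mul1r.
  transitivity (\sum_i c i * (1 - d i / d m) * 1); first by under [RHS]eq_bigr do rewrite mulr1.
  by rewrite (shift (fun=> 1)); under eq_bigr do rewrite mulr1.
- by move=> z; exact: shift.
- by exists m; rewrite divff -?normr_gt0// subrr mulr0.
Qed.

Lemma nearest_point_obtuse Z (p q f : Z -> R) :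
  (forall t, 0 <= t <= 1 ->
    \sum_z (p z - q z) ^+ 2 <= \sum_z (p z - ((1 - t) * q z + t * f z)) ^+ 2) ->
  \sum_z (p z - q z) * (f z - q z) <= 0.
Proof.
move=> nearest; set S := \sum_z _; pose D := \sum_z (f z - q z) ^+ 2.
have D0 : 0 <= D by rewrite sumr_ge0// => z _; exact: sqr_ge0.
have quad t : 0 <= t <= 1 -> 2 * t * S <= t ^+ 2 * D.
  move=> /nearest; have -> : \sum_z (p z - ((1 - t) * q z + t * f z)) ^+ 2 =
      \sum_z (p z - q z) ^+ 2 + (t ^+ 2 * D - 2 * t * S).
    by rewrite /D /S !mulr_sumr -sumrB -big_split; apply: eq_bigr => z _ /=; ring.
  by rewrite lerDl subr_ge0.
rewrite leNgt; apply/negP => S0; pose t := S / (S + D).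
have SD0 : 0 < S + D by lra.
have t0 : 0 < t by rewrite divr_gt0.
have t1 : t <= 1 by rewrite ler_pdivrMr//; lra.
have tS : t * S + t * D = S by rewrite -mulrDr divfK// gt_eqF.
have tS0 : 0 < t * S by rewrite mulr_gt0.
have := quad t; rewrite (ltW t0) t1 => /(_ isT).
rewrite (_ : 2 * t * S = t * (2 * S)); last by ring.
by rewrite expr2 -mulrA ler_pM2l//; lra.
Qed.

End Caratheodory.

Lemma continuous_sum (R : realType) (U : topologicalType) (J : finType) (g : J -> U -> R) :
  (forall j, continuous (g j)) -> continuous (fun u => \sum_j g j u).
Proof. by move=> cg; apply: continuous_big => //; exact: add_continuous. Qed.

Section CompactHull.
Variables (R : realType) (T : topologicalType) (Z I : finType).
Variables (D : set T) (f : T -> Z -> R).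
Hypotheses (D0 : D !=set0) (cD : compact D) (cf : forall z, continuous (f ^~ z)).

Let mixtures : topologicalType := prod_topology (fun _ : I => (R * T)%type : topologicalType).

Definition mixture (m : mixtures) (z : Z) : R := \sum_i (m i).1 * f (m i).2 z.

Definition mixture_of (m : mixtures) :=
  convex_weights (fun i => (m i).1) /\ forall i, D (m i).2.

Lemma continuous_component i : continuous (fun m : mixtures => m i).
Proof. exact: (@proj_continuous _ (fun _ : I => (R * T)%type : topologicalType) i). Qed.

Lemma continuous_weight i : continuous (fun m : mixtures => (m i).1).
Proof. by move=> m; apply: (cvg_comp _ _ (@continuous_component i m)); exact: cvg_fst. Qed.

Lemma continuous_point i : continuous (fun m : mixtures => (m i).2).
Proof. by move=> m; apply: (cvg_comp _ _ (@continuous_component i m)); exact: cvg_snd. Qed.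

Lemma continuous_mixture z : continuous (mixture ^~ z).
Proof.
apply: continuous_sum => i m; apply: (cvgM (@continuous_weight i m)).
exact: (cvg_comp _ _ (@continuous_point i m) (@cf z _)).
Qed.

Lemma compact_mixtures : compact mixture_of.
Proof.
pose box : set mixtures := [set m | forall i, (`[0, 1]%classic `*` D) (m i)].
pose total : set mixtures := [set m | \sum_i (m i).1 = 1].
have -> : mixture_of = box `&` total.
  apply/seteqP; split=> [m [[c0 c1] mD]|m [mbox m1]].
    split=> // i; split; last exact: mD.
    by rewrite /= in_itv /= c0 -c1 (bigD1 i) //= lerDl sumr_ge0.
  split; last by move=> i; case: (mbox i).
  by split=> // i; have [/= + _] := mbox i; rewrite in_itv => /andP[].
apply: compact_closedI.
  apply: (@tychonoff _ (fun _ : I => (R * T)%type : topologicalType)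
    (fun=> `[0, 1]%classic `*` D)).
  by move=> i; apply: compact_setX => //; exact: segment_compact.
apply: (@preimage_closed mixtures R (fun m => \sum_i (m i).1) [set 1]); last exact: closed_eq.
by move=> m _; apply: continuous_sum => i; exact: continuous_weight.
Qed.

Lemma nearest_mixture (p : Z -> R) (i0 : I) : exists2 m, mixture_of m &
  forall m', mixture_of m' ->
    \sum_z (p z - mixture m z) ^+ 2 <= \sum_z (p z - mixture m' z) ^+ 2.
Proof.
have [t0 Dt0] := D0.
have [] := @compact_EVT_min mixtures R (fun m => \sum_z (p z - mixture m z) ^+ 2) mixture_of.
- exists (fun i => ((i == i0)%:R, t0)); split=> //=; split=> [i|]; first exact: ler0n.
  rewrite -[RHS](sum_delta i0 (fun=> 1)).
  by apply: eq_bigr => i _; rewrite mulr1 eq_sym.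
- exact: compact_mixtures.
- apply: continuous_subspaceT; apply: continuous_sum => z m.
  have dist : (fun m => p z - mixture m z) @ m --> p z - mixture m z.
    exact: (cvgB (cvg_cst _) (@continuous_mixture z m)).
  by under eq_fun do rewrite expr2; exact: (cvgM dist dist).
by move=> m /set_mem mD mmin; exists m => // m' m'D; apply: mmin; exact: mem_set.
Qed.

(* Caratheodory frees a slot of [m] in which [t] is inserted. *)
Lemma mixture_insert m t s : (#|Z|.+1 < #|I|)%N -> mixture_of m -> D t -> 0 <= s <= 1 ->
  exists2 m', mixture_of m' & forall z, mixture m' z = (1 - s) * mixture m z + s * f t z.
Proof.
move=> ZI [cm Dm] Dt /andP[s0 s1].
have [c [[c0 c1] cmE [k0 ck0]]] := caratheodory (fun k => f (m k).2) ZI cm.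
pose m' k : R * T := if k == k0 then (s, t) else ((1 - s) * c k, (m k).2).
have m'E (F : T -> R) :
    \sum_k (m' k).1 * F (m' k).2 = (1 - s) * (\sum_k c k * F (m k).2) + s * F t.
  rewrite (bigD1 k0) //= {1 2}/m' eqxx addrC [in RHS](bigD1 k0) //= ck0 mul0r add0r.
  rewrite mulr_sumr; congr (_ + _); apply: eq_bigr => k /negPf kk0.
  by rewrite /m' kk0 mulrA.
exists m' => [|z]; last by rewrite /mixture (m'E (f ^~ z)) cmE.
split; last by move=> k; rewrite /m'; case: ifP => _; [exact: Dt|exact: Dm].
split=> [k|].
  by rewrite /m'; case: ifP => _ //=; rewrite mulr_ge0// subr_ge0.
have := m'E (fun=> 1); under eq_bigr do rewrite mulr1; move=> ->.
by under eq_bigr do rewrite mulr1; rewrite c1; ring.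
Qed.

End CompactHull.

Section Separation.
Variables (R : realType) (T : topologicalType) (Z : finType).
Variables (D : set T) (f : T -> Z -> R).
Hypotheses (D0 : D !=set0) (cD : compact D) (cf : forall z, continuous (f ^~ z)).

Lemma compact_hull_or_separated (p : Z -> R) :
  (exists K (c : 'I_K -> R) (t : 'I_K -> T), [/\ convex_weights c, forall k, D (t k) &
     forall z, p z = \sum_k c k * f (t k) z]) \/
  (exists (w : Z -> R) (b : R),
     (forall t, D t -> \sum_z w z * f t z <= b) /\ b < \sum_z w z * p z).
Proof.
have [m mD m_min] := nearest_mixture D0 cD cf p (ord0 : 'I_#|Z|.+2).
set q := mixture f m in m_min.
have [pq0|pq_neq0] := eqVneq (\sum_z (p z - q z) ^+ 2) 0.
  left; exists #|Z|.+2, (fun k => (m k).1), (fun k => (m k).2).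
  case: mD => cm Dm; split=> // z; apply/eqP; rewrite -subr_eq0 -sqrf_eq0; apply/eqP.
  exact: (psumr_eq0P (fun z _ => sqr_ge0 (p z - q z)) pq0).
right; exists (fun z => p z - q z), (\sum_z (p z - q z) * q z); split=> [t Dt|]; last first.
  rewrite -subr_gt0 -sumrB lt_neqAle eq_sym.
  under eq_bigr do rewrite -mulrBr -expr2.
  by rewrite pq_neq0 sumr_ge0// => z _; exact: sqr_ge0.
rewrite -subr_le0 -sumrB; under eq_bigr do rewrite -mulrBr.
apply: nearest_point_obtuse => s s01.
have [|m' m'D m'E] := mixture_insert f _ mD Dt s01; first by rewrite card_ord.
by have := m_min _ m'D; under [X in _ <= X -> _]eq_bigr do rewrite m'E.
Qed.

End Separation.

(** * Local measurements *)

Section Measurements.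
Variable R : realType.
Local Notation C := R[i].
Local Notation mat := (mat R).
Implicit Types A B I T X Y Z : finType.

(* The rows of an isometric [V] are the bras of a measurement with outcomes [Z]. *)
Definition outcome Z T (V : mat Z T) (M : mat T T) (z : Z) : R := Re (sandw V M z z).
Definition born Z T (V : mat Z T) (w : T -> C) (z : Z) : R := normc (mulmv V w z) ^+ 2.

Lemma outcome_ge0 Z T (V : mat Z T) M z : psd M -> 0 <= outcome V M z.
Proof. by move=> pM; exact/psd_diag_ge0/psd_sandw. Qed.

Lemma outcome_sum Z T (V : mat Z T) M : isometric V -> \sum_z outcome V M z = Re (trm M).
Proof. by move=> hV; rewrite -Re_sum -[in RHS](trm_sandw_isometric M hV). Qed.

Lemma outcome_subm Z T (V : mat Z T) M N z :
  outcome V (subm M N) z = outcome V M z - outcome V N z.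
Proof. by rewrite /outcome sandw_subm /subm; case: (sandw _ M _ _); case: (sandw _ N _ _). Qed.

Lemma sandw_lincomb I Z T (V : mat Z T) (c : I -> C) (M : I -> mat T T) x y :
  sandw V (fun i j => \sum_k c k * M k i j) x y = \sum_k c k * sandw V (M k) x y.
Proof.
rewrite -[LHS]/(sandw V (summ (fun k i j => c k * M k i j)) x y) sandw_summ.
apply: eq_bigr => k _; rewrite !sandwE mulr_sumr; apply: eq_bigr => i _.
by rewrite mulr_sumr; apply: eq_bigr => j _; ring.
Qed.

Lemma outcome_psd_real Z T (V : mat Z T) M z : psd M -> sandw V M z z = (outcome V M z)%:C.
Proof.
move=> pM; rewrite RRe_real//; apply: ger0_real.
by have := psd_sandw V pM (basis_vec z); rewrite -/(qform _ _) qform_basis.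
Qed.

Lemma sandw_ketbra_diag Z T (V : mat Z T) w z : sandw V (ketbra w) z z = (born V w z)%:C.
Proof. by rewrite sandw_ketbra /ketbra mulcJ. Qed.

Lemma born_sum Z T (V : mat Z T) w : isometric V -> \sum_z born V w z = sqnorm w.
Proof. exact: sqnorm_isometric. Qed.

Lemma born_kron X Y A B (V : mat X A) (U : mat Y B) a b z :
  born (kron V U) (pvec a b) z = born V a z.1 * born U b z.2.
Proof. by rewrite /born mulmv_kron_pvec Normc.normcM exprMn. Qed.

Lemma bornZ Z T (V : mat Z T) (r : R) w z :
  born V (fun i => r%:C * w i) z = r ^+ 2 * born V w z.
Proof.
rewrite /born (_ : mulmv V _ z = r%:C * mulmv V w z).
  by rewrite Normc.normcM normc_real exprMn real_normK ?num_real.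
by rewrite /mulmv mulr_sumr; apply: eq_bigr => i _; rewrite mulrCA.
Qed.

Lemma sandw_diag Z T (V : mat Z T) M z :
  sandw V M z z = qform M (fun i => conjc (V z i)).
Proof. by rewrite sandwE; do 2 apply: eq_bigr => ? _; rewrite conjcK. Qed.

Lemma qformZ T (M : mat T T) (c : C) w :
  qform M (fun i => c * w i) = (normc c ^+ 2)%:C * qform M w.
Proof.
rewrite -mulcJ /qform mulr_sumr; apply: eq_bigr => i _; rewrite mulr_sumr.
by apply: eq_bigr => j _; rewrite conjcM; ring.
Qed.

End Measurements.

Section PolarFrame.
Variable R : realType.
Local Notation C := R[i].
Local Notation mat := (mat R).
Implicit Types A B T : finType.

Definition polar_scale T : R := Num.sqrt (8 * #|T|)%:R^-1.

Definition polar_frame T : mat (polar_index T) T :=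
  fun x a => (polar_scale T)%:C * conjc (polar_vec x a).
Arguments polar_frame : clear implicits.

Lemma polar_scale_neq0 T : T -> polar_scale T != 0.
Proof.
move=> t; rewrite sqrtr_eq0 -ltNge invr_gt0 ltr0n muln_gt0.
by apply/card_gt0P; exists t.
Qed.

Lemma isometric_polar_frame T : isometric (polar_frame T).
Proof.
apply: matP => a a'; rewrite /mulm /adjm /polar_frame !sum_pair.
have basis_sum : \sum_i basis_vec i a * basis_vec i a' = idm T a a' :> C.
  rewrite /idm -(sum_delta a (fun i => (i == a')%:R)); apply: eq_bigr => i _.
  by rewrite /basis_vec [a' == i]eq_sym.
transitivity ((8 * #|T|)%:R^-1 * \sum_i \sum_j 4 * (basis_vec i a * basis_vec i a'
    + basis_vec j a * basis_vec j a') : C).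
  rewrite mulr_sumr; apply: eq_bigr => i _; rewrite mulr_sumr; apply: eq_bigr => j _.
  rewrite -sum_phases mulr_sumr -sqr_sqrt_invn; apply: eq_bigr => s _.
  rewrite conjcM conjcK conjc_real /polar_vec /= rmorphD /= conjcM !conjc_nat.
  by rewrite /polar_scale; ring.
under eq_bigr do rewrite -mulr_sumr big_split /= sumr_const basis_sum.
rewrite -mulr_sumr big_split /= sumrMnl basis_sum sumr_const -mulrnDl -mulr_natl natrM.
by field; rewrite pnatr_eq0 -lt0n; apply/card_gt0P; exists a.
Qed.

Definition polar_measurement A B : mat (polar_index A * polar_index B)%type (A * B)%type :=
  kron (polar_frame A) (polar_frame B).
Arguments polar_measurement : clear implicits.

Lemma isometric_polar_measurement A B : isometric (polar_measurement A B).
Proof. by apply: isometric_kron; exact: isometric_polar_frame. Qed.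

Lemma polar_measurement_separates A B (M : bop R A B) :
  (forall z, sandw (polar_measurement A B) M z z = 0) -> forall i j, M i j = 0.
Proof.
move=> M0 i; apply: qform_polar_pvec_eq0 => x y; have := M0 (x, y); rewrite sandw_diag.
have -> : (fun p => conjc (polar_measurement A B (x, y) p)) =
    (fun p => (polar_scale A * polar_scale B)%:C * pvec (polar_vec x) (polar_vec y) p).
  apply/funext => -[a b].
  rewrite /polar_measurement /kron /polar_frame /pvec /= !conjcM !conjcK !conjc_real.
  by rewrite rmorphM; ring.
rewrite qformZ normc_real => /eqP; rewrite mulf_eq0 => /orP[|/eqP//].
move=> /eqP/(@complexI R _ 0)/eqP; rewrite sqrf_eq0 normr_eq0 mulf_eq0.
by rewrite (negPf (polar_scale_neq0 i.1)) (negPf (polar_scale_neq0 i.2)).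
Qed.

End PolarFrame.

Arguments polar_frame {R} T.
Arguments polar_measurement {R} A B.

Section UnitSphere.
Variables (R : realType) (T : finType).
Local Notation C := R[i].

Definition coords := 'rV[R]_#|{: T * bool}|.

Definition cvec (r : coords) : T -> C :=
  fun t => Complex (r ord0 (enum_rank (t, true))) (r ord0 (enum_rank (t, false))).

Definition unit_sphere : set coords := [set r | sqnorm (cvec r) = 1].

Lemma cvec_surj (w : T -> C) : exists r, cvec r = w.
Proof.
exists (\row_i let: (t, b) := enum_val i in if b then Re (w t) else Im (w t)).
by apply/funext => t; rewrite /cvec /= !mxE !enum_rankK; case: (w t).
Qed.

Lemma continuous_Re_cvec t : continuous (fun r => Re (cvec r t)).
Proof. exact: coord_continuous. Qed.

Lemma continuous_Im_cvec t : continuous (fun r => Im (cvec r t)).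
Proof. exact: coord_continuous. Qed.

Lemma continuous_born (Z : finType) (V : mat R Z T) z : continuous (fun r => born V (cvec r) z).
Proof.
pose re r := \sum_t (Re (V z t) * Re (cvec r t) - Im (V z t) * Im (cvec r t)).
pose im r := \sum_t (Re (V z t) * Im (cvec r t) + Im (V z t) * Re (cvec r t)).
have bornE r : born V (cvec r) z = re r * re r + im r * im r.
  rewrite /born sqr_normcE Re_sum Im_sum -!expr2.
  by congr (_ ^+ 2 + _ ^+ 2); apply: eq_bigr => t _; case: (V z t).
have scale c (g : coords -> R) : continuous g -> continuous (fun r => c * g r).
  by move=> cg r; exact: (cvgM (cvg_cst _) (cg r)).
have c_re : continuous re.
  apply: continuous_sum => t r.
  exact: (cvgB (scale _ _ (@continuous_Re_cvec t) r) (scale _ _ (@continuous_Im_cvec t) r)).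
have c_im : continuous im.
  apply: continuous_sum => t r.
  exact: (cvgD (scale _ _ (@continuous_Im_cvec t) r) (scale _ _ (@continuous_Re_cvec t) r)).
under eq_fun do rewrite bornE.
by move=> r; exact: (cvgD (cvgM (c_re r) (c_re r)) (cvgM (c_im r) (c_im r))).
Qed.

Lemma compact_unit_sphere : compact unit_sphere.
Proof.
pose box : set coords := [set v | forall i, `[-1, 1]%classic (v ord0 i)].
have -> : unit_sphere = box `&` unit_sphere.
  apply/esym/setIidPr => r r1 i; rewrite /= in_itv -ler_norml -(@expr_le1 _ 2)//.
  rewrite real_normK ?num_real//; case: (enum_val i) (enum_valK i) => t b <-.
  have := normc_le_sqnorm (cvec r) t; rewrite r1 sqr_normcE.
  by have := sqr_ge0 (Re (cvec r t)); have := sqr_ge0 (Im (cvec r t)); case: b => /=; lra.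
apply: compact_closedI.
  by apply: (@rV_compact R _ (fun=> `[-1, 1]%classic)) => i; exact: segment_compact.
apply: (@preimage_closed coords R (fun r => sqnorm (cvec r)) [set 1]); last exact: closed_eq.
move=> r _; rewrite (_ : (fun r => sqnorm _) = fun r => \sum_t born (idm T) (cvec r) t).
  by apply: continuous_sum => t; exact: continuous_born.
by apply/funext => {}r; rewrite born_sum//; exact: isometric1.
Qed.

Lemma unit_sphere_nonempty : inhabited T -> unit_sphere !=set0.
Proof.
move=> [t]; have [r er] := cvec_surj (basis_vec t).
by exists r; rewrite /unit_sphere /= er sqnorm_basis.
Qed.

Lemma unit_vector_multiple (w : T -> C) : inhabited T ->
  exists (r : R) (u : T -> C), sqnorm u = 1 /\ w = fun t => r%:C * u t.
Proof.
move=> [t]; have [w0|w_neq0] := eqVneq (sqnorm w) 0.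
  exists 0, (basis_vec t); split; first exact: sqnorm_basis.
  by apply/funext => i; rewrite (sqnorm_eq0 w0) rmorph0 mul0r.
exists (Num.sqrt (sqnorm w)), (fun t => (Num.sqrt (sqnorm w))^-1%:C * w t); split.
  by rewrite sqnormZ exprVn sqr_sqrtr ?sqnorm_ge0// mulVf.
apply/funext => i; rewrite mulrA -rmorphM mulfV ?mul1r//.
by rewrite sqrtr_eq0 -ltNge lt_neqAle eq_sym w_neq0 sqnorm_ge0.
Qed.

End UnitSphere.

Arguments unit_sphere : clear implicits.

(** * Tilted local measurements detect entanglement *)

Section Witness.
Variable R : realType.
Local Notation C := R[i].
Local Notation mat := (mat R).

Lemma mixture_of_pvec_separable (A B : finType) K (c : 'I_K -> R)
    (a : 'I_K -> A -> C) (b : 'I_K -> B -> C) :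
  convex_weights c -> (forall k, sqnorm (a k) = 1) -> (forall k, sqnorm (b k) = 1) ->
  separable (fun x y => \sum_k (c k)%:C * ketbra (pvec (a k) (b k)) x y).
Proof.
move=> [c0 c1] a1 b1; exists K, c, (fun k => ketbra (a k)), (fun k => ketbra (b k)).
split=> //; split=> //; split=> [k|x y]; first by split; exact: state_ketbra.
by apply: eq_bigr => k _; rewrite /kron /ketbra /pvec conjcM; congr (_ * _); ring.
Qed.

Lemma separable_of_mixed_outcome (A B : finType) (rho : bop R A B) K (c : 'I_K -> R)
    (a : 'I_K -> A -> C) (b : 'I_K -> B -> C) :
  psd rho -> convex_weights c -> (forall k, sqnorm (a k) = 1) -> (forall k, sqnorm (b k) = 1) ->
  (forall z, outcome (polar_measurement A B) rho z =
     \sum_k c k * born (polar_measurement A B) (pvec (a k) (b k)) z) ->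
  separable rho.
Proof.
move=> prho cc a1 b1 outE.
suff -> : rho = fun x y => \sum_k (c k)%:C * ketbra (pvec (a k) (b k)) x y.
  exact: mixture_of_pvec_separable.
apply: matP => i j; apply/eqP; rewrite -subr_eq0; apply/eqP; move: i j.
apply: polar_measurement_separates => z; rewrite -/(subm rho _) sandw_subm /subm.
rewrite outcome_psd_real// outE sandw_lincomb rmorph_sum.
under [X in _ - X]eq_bigr do rewrite sandw_ketbra_diag -rmorphM.
exact: subrr.
Qed.

Lemma entangled_separated (A B : finType) (rho : bop R A B) : entangled rho ->
  exists (w : polar_index A * polar_index B -> R) (m : R),
    (forall a b, sqnorm a = 1 -> sqnorm b = 1 ->
       \sum_z w z * born (polar_measurement A B) (pvec a b) z <= m) /\
    m < \sum_z w z * outcome (polar_measurement A B) rho z.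
Proof.
move=> [[prho rho1] nsep]; have [[a0 b0]] := trm1_inhabited rho1.
set V := polar_measurement A B; pose D := unit_sphere R A `*` unit_sphere R B.
pose f (r : coords R A * coords R B) z := born V (pvec (cvec r.1) (cvec r.2)) z.
have D0 : D !=set0.
  have [r r1] := @unit_sphere_nonempty R A (inhabits a0).
  by have [s s1] := @unit_sphere_nonempty R B (inhabits b0); exists (r, s).
have cD : compact D := compact_setX (@compact_unit_sphere R A) (@compact_unit_sphere R B).
have cf z : continuous (f ^~ z).
  have bornA : continuous (fun r : coords R A * coords R B =>
      born (polar_frame A) (cvec r.1) z.1).
    move=> r; apply: (@continuous_comp _ _ _ fst (fun s => born (polar_frame A) (cvec s) z.1)).
      exact: cvg_fst.
    exact: continuous_born.
  have bornB : continuous (fun r : coords R A * coords R B =>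
      born (polar_frame B) (cvec r.2) z.2).
    move=> r; apply: (@continuous_comp _ _ _ snd (fun s => born (polar_frame B) (cvec s) z.2)).
      exact: cvg_snd.
    exact: continuous_born.
  by move=> r; rewrite /f; under eq_fun do rewrite born_kron; exact: (cvgM (bornA r) (bornB r)).
have [[K [c [t [cc Dt outE]]]]|[w [m [w_le w_gt]]]] :=
    compact_hull_or_separated D0 cD cf (outcome V rho).
  by exfalso; apply: nsep; apply: separable_of_mixed_outcome outE => // k; case: (Dt k).
exists w, m; split=> // a b a1 b1.
have [r ra] := cvec_surj a; have [s sb] := cvec_surj b.
by have := w_le (r, s); rewrite /f /= ra sb; apply; split; rewrite /unit_sphere /= ?ra ?sb.
Qed.

Definition product_bounded (A B X Y : finType) (V : mat X A) (U : mat Y B) (g : X * Y -> R) :=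
  forall a b, \sum_z g z * born (kron V U) (pvec a b) z <= sqnorm a * sqnorm b.

Lemma entangled_witness (A B : finType) (rho : bop R A B) : entangled rho ->
  exists w : polar_index A * polar_index B -> R,
    (forall a b, \sum_z w z * born (polar_measurement A B) (pvec a b) z <= 0) /\
    0 < \sum_z w z * outcome (polar_measurement A B) rho z.
Proof.
move=> ent; have [[prho rho1] _] := ent; have [[a0 b0]] := trm1_inhabited rho1.
have hV := @isometric_polar_measurement R A B.
have [w [m [w_le w_gt]]] := entangled_separated ent.
have shift (F : _ -> R) : \sum_z F z = 1 ->
    \sum_z (w z - m) * F z = \sum_z w z * F z - m.
  by move=> F1; under eq_bigr do rewrite mulrBl; rewrite sumrB -mulr_sumr F1 mulr1.
exists (fun z => w z - m); split; last first.
  by rewrite shift ?subr_gt0// outcome_sum// rho1.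
move=> a b; have [r [a' [a1 ->]]] := unit_vector_multiple a (inhabits a0).
have [s [b' [b1 ->]]] := unit_vector_multiple b (inhabits b0).
have -> : pvec (fun t => r%:C * a' t) (fun t => s%:C * b' t) = fun p => (r * s)%:C * pvec a' b' p.
  by apply/funext => p; rewrite /pvec rmorphM; ring.
under eq_bigr do rewrite bornZ mulrCA.
rewrite -mulr_sumr mulr_ge0_le0 ?sqr_ge0// shift ?subr_le0 ?w_le//.
by rewrite born_sum// sqnorm_pvec a1 b1 mulr1.
Qed.

End Witness.

Section Tilt.
Variable R : realType.
Local Notation mat := (mat R).

Lemma inv_one_plus_le (y : R) : `|y| <= 2^-1 -> (1 + y)^-1 <= 1 - y + 2 * y ^+ 2.
Proof.
rewrite ler_norml => /andP[y_ge y_le]; rewrite -[leLHS]mul1r ler_pdivrMr; last by lra.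
by have := sqr_ge0 y; nra.
Qed.

(* First-order expansion: the mean of [1 / (1 + e * w)] is [1 - e * d + O(e^2)]. *)
Lemma tilt_mean_inv_lt1 (Z : finType) (p w : Z -> R) :
  (forall z, 0 <= p z) -> \sum_z p z = 1 -> 0 < \sum_z w z * p z ->
  exists e, [/\ 0 < e, forall z, 0 < 1 + e * w z & \sum_z p z / (1 + e * w z) < 1].
Proof.
move=> p0 p1; set d := \sum_z _ => d0; pose W := \sum_z `|w z|.
have w_le z : `|w z| <= W by rewrite /W (bigD1 z) //= lerDl sumr_ge0.
have dW : d <= W.
  rewrite -[W]mulr1 -p1 mulr_sumr; apply: ler_sum => z _.
  by rewrite ler_wpM2r// (le_trans (ler_norm _)).
have W0 : 0 < W by lra.
pose e := d / (4 * W ^+ 2).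
have e0 : 0 < e by rewrite divr_gt0// mulr_gt0// exprn_gt0.
have eWW : e * W ^+ 2 = d / 4 by rewrite /e; field; rewrite gt_eqF.
have eW : e * W <= 4^-1.
  by rewrite -(ler_pM2r W0) -mulrA -expr2 eWW; lra.
have small z : `|e * w z| <= 4^-1.
  by rewrite normrM gtr0_norm// (le_trans _ eW)// ler_wpM2l// ltW.
exists e; split=> // [z|]; first by have := small z; rewrite ler_norml; lra.
have mean_le : \sum_z p z / (1 + e * w z) <=
    \sum_z (p z - e * (w z * p z) + 2 * (e * W) ^+ 2 * p z).
  apply: ler_sum => z _.
  apply: (@le_trans _ _ (p z * (1 - e * w z + 2 * (e * w z) ^+ 2))).
    by rewrite ler_wpM2l// inv_one_plus_le// (le_trans (small z))//; lra.
  have ewW : `|e * w z| <= e * W by rewrite normrM gtr0_norm// ler_pM2l.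
  have : (e * w z) ^+ 2 <= (e * W) ^+ 2.
    by rewrite -real_normK ?num_real// lerXn2r// nnegrE (le_trans _ ewW).
  by move=> /(ler_wpM2l (p0 z)); nra.
apply: le_lt_trans mean_le _.
rewrite big_split sumrB /= -!mulr_sumr p1 -/d mulr1 exprMn expr2 -mulrA eWW.
by have := mulr_gt0 e0 d0; lra.
Qed.

Lemma entangled_tilt (A B : finType) (rho : bop R A B) : entangled rho ->
  exists (X Y : finType) (V : mat X A) (U : mat Y B) (g : X * Y -> R),
    [/\ isometric V, isometric U, forall z, 0 < g z, product_bounded V U g &
        \sum_z outcome (kron V U) rho z / g z < 1].
Proof.
move=> ent; have [[prho rho1] _] := ent; have [w [w_le w_gt]] := entangled_witness ent.
have hV := @isometric_polar_measurement R A B.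
have [|e [e0 g0 mean_lt1]] := tilt_mean_inv_lt1 (fun z => outcome_ge0 _ z prho) _ w_gt.
  by rewrite outcome_sum// rho1.
exists (polar_index A), (polar_index B), (polar_frame A), (polar_frame B).
exists (fun z => 1 + e * w z); split=> //; try exact: isometric_polar_frame; move=> a b.
under eq_bigr do rewrite mulrDl mul1r -mulrA.
by rewrite big_split /= born_sum// sqnorm_pvec -mulr_sumr gerDl pmulr_rle0.
Qed.

End Tilt.

(** * Hypothesis tests on many copies *)

Section ConsFinfun.
Variables (T : finType) (m : nat).

Definition fcons (t : T) (f : {ffun 'I_m -> T}) : {ffun 'I_m.+1 -> T} :=
  [ffun i => oapp f t (unlift ord0 i)].

Lemma fcons0 t f : fcons t f ord0 = t.
Proof. by rewrite ffunE unlift_none. Qed.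

Lemma fconsS t f i : fcons t f (lift ord0 i) = f i.
Proof. by rewrite ffunE liftK. Qed.

Lemma sum_fcons (V : nmodType) (F : {ffun 'I_m.+1 -> T} -> V) :
  \sum_f F f = \sum_t \sum_f F (fcons t f).
Proof.
rewrite (reindex (fun p => fcons p.1 p.2)) /=; first by rewrite sum_pair.
pose uncons (f : {ffun 'I_m.+1 -> T}) := (f ord0, [ffun i => f (lift ord0 i)]).
apply: onW_bij; exists uncons => [[t f]|f]; rewrite /uncons.
  by rewrite fcons0; congr (_, _); apply/ffunP => i; rewrite ffunE fconsS.
apply/ffunP => i; case: (unliftP ord0 i) => [j|] ->; first by rewrite fconsS ffunE.
by rewrite fcons0.
Qed.

End ConsFinfun.

Section ProductBoundedTensor.
Variable R : realType.
Local Notation C := R[i].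
Local Notation mat := (mat R).
Variables (A B X Y : finType) (V : mat X A) (U : mat Y B) (g : X * Y -> R).

Definition weight_tensor m (z : {ffun 'I_m -> X} * {ffun 'I_m -> Y}) : R :=
  \prod_k g (z.1 k, z.2 k).

Lemma weight_tensor_cons m x y (z : {ffun 'I_m -> X} * {ffun 'I_m -> Y}) :
  weight_tensor (fcons x z.1, fcons y z.2) = g (x, y) * weight_tensor z.
Proof.
rewrite /weight_tensor big_ord_recl /= !fcons0; congr (_ * _).
by apply: eq_bigr => k _; rewrite !fconsS.
Qed.

(* The unnormalised state of the last [m] copies after the first copy was found in [x]. *)
Definition residual (S T : finType) (W : mat S T) m (a : {ffun 'I_m.+1 -> T} -> C) (x : S) :
  {ffun 'I_m -> T} -> C := fun f => mulmv W (fun i => a (fcons i f)) x.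

Lemma mulmv_powm_fcons (S T : finType) (W : mat S T) m (a : {ffun 'I_m.+1 -> T} -> C) x f :
  mulmv (powm _ W) a (fcons x f) = mulmv (powm _ W) (residual W a x) f.
Proof.
rewrite {1}/mulmv sum_fcons exchange_big; apply: eq_bigr => h _ /=.
rewrite /residual /mulmv mulr_sumr; apply: eq_bigr => i _.
rewrite /powm /tensm big_ord_recl !fcons0 /= mulrCA mulrA; congr (_ * _ * _).
by apply: eq_bigr => k _; rewrite !fconsS.
Qed.

Lemma sqnorm_fcons (T : finType) m (a : {ffun 'I_m.+1 -> T} -> C) :
  sqnorm a = \sum_f sqnorm (fun i => a (fcons i f)).
Proof. by rewrite /sqnorm sum_fcons exchange_big. Qed.

Lemma born_fcons m a b x y (z : {ffun 'I_m -> X} * {ffun 'I_m -> Y}) :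
  born (kron (powm _ V) (powm _ U)) (pvec a b) (fcons x z.1, fcons y z.2) =
  born (kron (powm _ V) (powm _ U)) (pvec (residual V a x) (residual U b y)) z.
Proof. by rewrite !born_kron /born !mulmv_powm_fcons. Qed.

Hypotheses (g_ge0 : forall z, 0 <= g z) (bounded : product_bounded V U g).

Lemma residual_product_bounded m (a : {ffun 'I_m.+1 -> A} -> C) (b : {ffun 'I_m.+1 -> B} -> C) :
  \sum_z g z * (sqnorm (residual V a z.1) * sqnorm (residual U b z.2)) <= sqnorm a * sqnorm b.
Proof.
have -> : \sum_z g z * (sqnorm (residual V a z.1) * sqnorm (residual U b z.2)) =
    \sum_f \sum_h \sum_z g z *
      born (kron V U) (pvec (fun i => a (fcons i f)) (fun j => b (fcons j h))) z.
  under [RHS]eq_bigr do rewrite exchange_big; rewrite [RHS]exchange_big.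
  apply: eq_bigr => z _; rewrite mulr_suml mulr_sumr; apply: eq_bigr => f _.
  by rewrite !mulr_sumr; apply: eq_bigr => h _; rewrite born_kron.
rewrite (sqnorm_fcons a) (sqnorm_fcons b) mulr_suml; apply: ler_sum => f _.
by rewrite mulr_sumr; apply: ler_sum => h _; exact: bounded.
Qed.

(* The copies are contracted one at a time: measuring one copy of a product
   vector leaves a product vector. *)
Lemma product_bounded_tensor m :
  product_bounded (powm m V) (powm m U) (@weight_tensor m).
Proof.
elim: m => [|m IH] a b.
  under eq_bigr do rewrite /weight_tensor big_ord0 mul1r.
  by rewrite born_sum ?sqnorm_pvec//; apply: isometric_kron; apply: isometric_tensm => -[].
apply: le_trans (residual_product_bounded a b).
rewrite sum_pair sum_fcons; under eq_bigr do under eq_bigr do rewrite sum_fcons.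
rewrite [leRHS]sum_pair; apply: ler_sum => x _; rewrite exchange_big; apply: ler_sum => y _ /=.
apply: le_trans (ler_wpM2l (g_ge0 _) (IH _ _)).
rewrite sum_pair mulr_sumr le_eqVlt; apply/orP; left; apply/eqP.
apply: eq_bigr => f _; rewrite mulr_sumr; apply: eq_bigr => h _.
by rewrite (weight_tensor_cons x y (f, h)) (born_fcons a b x y (f, h)) -mulrA.
Qed.

End ProductBoundedTensor.

Section Tests.
Variable R : realType.
Local Notation C := R[i].
Local Notation mat := (mat R).

Lemma sandw_powm_tpow (A B X Y : finType) (V : mat X A) (U : mat Y B) (rho : bop R A B) m :
  sandw (kron (powm _ V) (powm _ U)) (tpow rho m) = tpow (sandw (kron V U) rho) m.
Proof.
apply: matP => z z'; rewrite /tpow; under [RHS]eq_bigr do rewrite sandwE.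
rewrite prod_sum_pair sandwE; apply: eq_bigr => f _.
rewrite prod_sum_pair; apply: eq_bigr => h _.
by rewrite !big_split /= -rmorph_prod /kron /powm /tensm !big_split.
Qed.

Lemma outcome_tpow (A B X Y : finType) (V : mat X A) (U : mat Y B) (rho : bop R A B) m z :
  psd rho -> outcome (kron (powm _ V) (powm _ U)) (tpow rho m) z
  = weight_tensor (outcome (kron V U) rho) z.
Proof.
move=> prho; rewrite /outcome sandw_powm_tpow /tpow.
by under eq_bigr do rewrite outcome_psd_real//; rewrite -rmorph_prod.
Qed.

Lemma mean_inv_weight_tensor (A B X Y : finType) (V : mat X A) (U : mat Y B)
    (g : X * Y -> R) (rho : bop R A B) m : psd rho ->
  \sum_z outcome (kron (powm _ V) (powm _ U)) (tpow rho m) z / weight_tensor g z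
  = (\sum_z outcome (kron V U) rho z / g z) ^+ m.
Proof.
move=> prho; under eq_bigr do rewrite outcome_tpow//.
rewrite -[m in RHS]card_ord -prodr_const.
rewrite (prod_sum_pair (fun _ z => outcome (kron V U) rho z / g z)).
by apply: eq_bigr => z _; rewrite big_split prodfV.
Qed.

Lemma sum_outcome_le_tnorm (Z T : finType) (V : mat Z T) (e : Z -> R) (M : mat T T) :
  isometric V -> herm M -> (forall z, `|e z| <= 1) -> \sum_z e z * outcome V M z <= tnorm M.
Proof.
move=> hV hM e1; have hE : numradius_le1 (sandw (adjm V) (diagm e)).
  move=> w; rewrite qform_sandw adjmK qform_diagm normc_real -(sqnorm_isometric w hV).
  rewrite (le_trans (ler_norm_sum _ _ _))//; apply: ler_sum => z _.
  by rewrite normrM [X in _ * X]ger0_norm ?sqr_ge0// ler_piMl ?sqr_ge0.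
apply: le_trans (le_tnorm hM hE); apply: le_trans (Re_le_normc _).
rewrite trm_mulmC trm_sandw adjmK trm_mulm_diagm Re_sum; apply: ler_sum => z _.
by rewrite /outcome; case: (sandw V M z z) => x y /=; rewrite mul0r subr0.
Qed.

(* A maximally entangled state of Schmidt rank [#|D|] gains at most a factor
   [#|D|] over product vectors, by Cauchy-Schwarz over its Schmidt terms. *)
Lemma outcome_kron_maxent_le (D A B X Y : finType) (V : mat X A) (U : mat Y B)
    (K : mat A D) (L : mat B D) z :
  outcome (kron V U) (sandw (kron K L) (maxent D)) z
  <= \sum_i born (kron V U) (pvec (K ^~ i) (L ^~ i)) z.
Proof.
rewrite /outcome -sandw_mulm mulm_kron sandw_kron_maxent /ketbra mulcJ.
have -> : #|D|%:R^-1 = (#|D|%:R^-1 : R)%:C by rewrite fmorphV rmorph_nat.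
rewrite -rmorphM /=.
have [/card0_eq D0|D_gt0] := posnP #|D|.
  by rewrite !big1 ?Normc.normc0 ?expr0n ?mulr0// => i _; have := D0 i; rewrite inE.
rewrite mulrC ler_pdivrMr ?ltr0n// mulrC (le_trans (sqr_normc_sum_le _))//.
rewrite ler_pM2l ?ltr0n//; apply: ler_sum => i _.
by rewrite born_kron /born -exprMn -Normc.normcM.
Qed.

Lemma LOCC_maxent_outcome_le (D A B X Y : finType) (V : mat X A) (U : mat Y B)
    (g : X * Y -> R) (Lam : bop R D D -> bop R A B) :
  LOCC Lam -> (forall z, 0 <= g z) -> product_bounded V U g ->
  \sum_z g z * outcome (kron V U) (Lam (maxent D)) z <= #|D|%:R.
Proof.
move=> /LOCC_separable_channel[s [hs ->]] g0 bounded.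
have outcome_le z : outcome (kron V U) (krausmap (@joint_op _ _ _ _ _ s) (maxent D)) z
    <= \sum_(o : outcomes s) \sum_i born (kron V U) (pvec (alice_op o ^~ i) (bob_op o ^~ i)) z.
  rewrite /outcome sandw_summ /summ Re_sum; apply: ler_sum => o _; exact: outcome_kron_maxent_le.
apply: (@le_trans _ _ (\sum_o \sum_i
    sqnorm (alice_op (o : outcomes s) ^~ i) * sqnorm (bob_op o ^~ i))).
  apply: (@le_trans _ _ (\sum_z g z * \sum_(o : outcomes s) \sum_i
      born (kron V U) (pvec (alice_op o ^~ i) (bob_op o ^~ i)) z)).
    by apply: ler_sum => z _; rewrite ler_wpM2l.
  under eq_bigr do rewrite mulr_sumr; rewrite exchange_big; apply: ler_sum => o _ /=.
  under eq_bigr do rewrite mulr_sumr; rewrite exchange_big; apply: ler_sum => i _ /=.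
  exact: bounded.
rewrite exchange_big -[leRHS]/(#|predT|%:R) -sumr_const; apply: ler_sum => i _.
rewrite -(sqnorm_basis R (i, i)) -hs le_eqVlt; apply/orP; left; apply/eqP.
by apply: eq_bigr => o _; rewrite mulmv_basis -sqnorm_pvec.
Qed.

Lemma threshold_le (s x : R) : 0 < s -> 0 < x ->
  (s <= x)%R%:R <= x / s /\ 1 - (s <= x)%R%:R <= s / x.
Proof.
move=> s0 x0; have [sx|xs] := leP s x; rewrite /= ?subrr ?subr0; split.
- by rewrite ler_pdivlMr// mul1r.
- by rewrite divr_ge0// ltW.
- by rewrite divr_ge0// ltW.
- by rewrite ler_pdivlMr// mul1r ltW.
Qed.

End Tests.

Section ThresholdTest.
Variables (R : realType) (A B X Y : finType) (V : mat R X A) (U : mat R Y B).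
Variables (g : X * Y -> R) (rho : bop R A B) (t : R) (m : nat).
Hypotheses (isoV : isometric V) (isoU : isometric U).
Hypotheses (g_gt0 : forall z, 0 < g z) (bounded : product_bounded V U g) (t_gt0 : 0 < t).
Hypothesis st_rho : is_state rho.

Local Notation W := (kron (powm m V) (powm m U)).

Definition accepts (z : {ffun 'I_m -> X} * {ffun 'I_m -> Y}) : R :=
  (t ^+ m <= weight_tensor g z)%R%:R.

Let isoW : isometric W.
Proof. by apply: isometric_kron; exact: isometric_powm. Qed.

Let weight_gt0 z : 0 < @weight_tensor R X Y g m z.
Proof. exact: prodr_gt0. Qed.

Let tm_gt0 : 0 < t ^+ m.
Proof. exact: exprn_gt0. Qed.

Lemma LOCC_maxent_accepts_le (D : finType) (Lam : bop R D D -> copies R A B m) : LOCC Lam ->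
  \sum_z accepts z * outcome W (Lam (maxent D)) z <= t ^- m * #|D|%:R.
Proof.
move=> locc; have boundedG := product_bounded_tensor (m := m) (fun z => ltW (g_gt0 z)) bounded.
have mean_le := LOCC_maxent_outcome_le locc (fun z => ltW (weight_gt0 z)) boundedG.
apply: le_trans (ler_wpM2l _ mean_le).
  rewrite mulr_sumr; apply: ler_sum => z _; rewrite mulrA ler_wpM2r ?outcome_ge0//.
    exact/(LOCC_psd locc)/psd_maxent.
  by rewrite mulrC; case: (threshold_le tm_gt0 (weight_gt0 z)).
by rewrite invr_ge0 ltW.
Qed.

Lemma tpow_accepts_ge :
  1 - (t * \sum_z outcome (kron V U) rho z / g z) ^+ m
  <= \sum_z accepts z * outcome W (tpow rho m) z.
Proof.
case: st_rho => prho rho1.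
have total : \sum_z outcome W (tpow rho m) z = 1 by rewrite outcome_sum// trm_tpow rho1 expr1n.
rewrite lerBlDr -lerBlDl -[X in X - _]total -sumrB exprMn -mean_inv_weight_tensor// mulr_sumr.
apply: ler_sum => z _; rewrite -[X in X - _]mul1r -mulrBl mulrCA mulrC.
rewrite ler_wpM2l ?outcome_ge0//; first exact: psd_tpow.
by case: (threshold_le tm_gt0 (weight_gt0 z)).
Qed.

Lemma LOCC_maxent_far (D : finType) (Lam : bop R D D -> copies R A B m) : LOCC Lam ->
  1 - (t * \sum_z outcome (kron V U) rho z / g z) ^+ m - t ^- m * #|D|%:R
  <= tnorm (subm (Lam (maxent D)) (tpow rho m)).
Proof.
move=> locc; have herm_diff : herm (subm (Lam (maxent D)) (tpow rho m)).
  apply: herm_subm; last exact/herm_tpow/psd_herm/st_rho.1.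
  exact/LOCC_herm/psd_herm/psd_maxent.
have accepts_le1 z : `|- accepts z| <= 1 by rewrite normrN normr_nat lern1 leq_b1.
apply: le_trans (sum_outcome_le_tnorm isoW herm_diff accepts_le1).
under [leRHS]eq_bigr do rewrite outcome_subm mulNr mulrBr opprB.
by rewrite sumrB; have := LOCC_maxent_accepts_le locc; have := tpow_accepts_ge; lra.
Qed.

End ThresholdTest.

(** * Entanglement cost and the symmetry of entanglement *)

Section EntanglementCost.
Variable R : realType.
Implicit Types A B : finType.

Lemma expr_lt_eventually (q e : R) : 0 <= q < 1 -> 0 < e -> \forall n \near \oo, q ^+ n < e.
Proof.
move=> /andP[q0 q1] e0; apply: (cvgr_lt (0 : R)) => //.
by apply: cvg_expr; rewrite ger0_norm.
Qed.

Lemma exists_expr_ge (t c : R) : 1 < t -> 0 < c -> exists2 l, (0 < l)%N & c <= t ^+ l.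
Proof.
move=> t1 c0; have t0 : 0 < t by lra.
have : \forall n \near \oo, t^-1 ^+ n < c^-1 /\ (0 < n)%N.
  apply: filterI; last exact: nbhs_infty_gt.
  by apply: expr_lt_eventually; rewrite ?invr_gt0// invr_ge0 ltW//= invf_lt1.
case=> l _ /(_ l (leqnn l)) [tl l0]; exists l => //.
by move: tl; rewrite exprVn ltf_pV2 ?posrE ?exprn_gt0// => /ltW.
Qed.

Lemma rate_psi_plus_lty A B (rho : bop R A B) : entangled rho -> (rate psi_plus rho < +oo)%E.
Proof.
move=> ent; have [st _] := ent.
have [X [Y [V [U [g [hV hU g0 bounded]]]]]] := entangled_tilt ent.
set a := \sum_z _ => a1.
have a0 : 0 <= a.
  by apply: sumr_ge0 => z _; rewrite divr_ge0 ?(ltW (g0 z))// outcome_ge0//; case: st.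
pose t := 2 / (1 + a).
have t1 : 1 < t by rewrite ltr_pdivlMr; lra.
have t0 : 0 < t by lra.
have ta : 0 <= t * a < 1 by rewrite mulr_ge0 ?(ltW t0)//= /t mulrAC ltr_pdivrMr; lra.
have [l l0 tl] : exists2 l, (0 < l)%N & 4 <= t ^+ l by apply: exists_expr_ge => //; lra.
have ta_small : \forall n \near \oo, (t * a) ^+ n < 4^-1.
  by apply: expr_lt_eventually => //; lra.
have half_small : \forall n \near \oo, (2^-1 : R) ^+ n < 4^-1.
  by apply: expr_lt_eventually; lra.
apply: (@le_lt_trans _ _ l%:R%:E); last exact: ltry.
apply: (@rate_le_natr _ _ _ _ _ _ _ _ 4^-1); first by rewrite invr_gt0.
near=> n => m Lam lnm locc; rewrite tpow_psi_plus.
have nm : (n <= m)%N by rewrite (leq_trans _ lnm)// leq_pmull.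
have ta_m : (t * a) ^+ m <= 4^-1.
  apply: (@le_trans _ _ ((t * a) ^+ n)).
    by case/andP: ta => ? ?; rewrite ler_wiXn2l// ltW.
  by apply: ltW; near: n.
have half_n : (2^-1 : R) ^+ n < 4^-1 by near: n.
have gain_m : t ^- m * 2 ^+ n <= 2^-1 ^+ n.
  rewrite mulrC ler_pdivrMr ?exprn_gt0//.
  apply: (@le_trans _ _ (2^-1 ^+ n * t ^+ (l * n))).
    by rewrite exprM -exprMn lerXn2r ?nnegrE//; lra.
  by rewrite ler_pM2l ?exprn_gt0 ?invr_gt0// ler_weXn2l// ltW.
have := LOCC_maxent_far hV hU g0 bounded t0 st locc.
by rewrite -/a card_ffun !card_ord natrX; lra.
Unshelve. all: by end_near. Qed.

End EntanglementCost.

Section RoundTrip.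
Local Open Scope ereal_scope.
Variables (R : realType) (A B A' : finType) (rho : bop R A B) (sigma : bop R A' A').
Hypotheses (st_rho : is_state rho) (st_sigma : is_state sigma).
Hypothesis swap_sigma : swapop sigma = sigma.

Let herm_rho : herm rho.
Proof. exact/psd_herm/st_rho.1. Qed.

Let herm_sigma : herm sigma.
Proof. exact/psd_herm/st_sigma.1. Qed.

Lemma rate_to_swapop : rate sigma (swapop rho) = rate sigma rho.
Proof. by rewrite -{1}swap_sigma rate_swapop. Qed.

Lemma roundtrip_rate_le_sym_ent : rate rho sigma * rate sigma rho <= sym_ent rho.
Proof.
rewrite -rate_to_swapop.
exact: rate_trans st_rho.2 st_sigma.2 herm_rho herm_sigma (herm_swapop herm_rho).
Qed.

Lemma rate_mul_sym_ent_le : rate sigma rho * sym_ent rho <= rate sigma rho.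
Proof.
rewrite -[leRHS]rate_to_swapop.
exact: rate_trans st_sigma.2 st_rho.2 herm_sigma herm_rho (herm_swapop herm_rho).
Qed.

End RoundTrip.

Section SymmetryOfEntanglement.
Local Open Scope ereal_scope.
Variables (R : realType) (A B : finType) (rho : bop R A B).
Hypothesis ent : entangled rho.

Lemma E_c_gt0_fin :
  exists r : R, [/\ (0 < r)%R, rate psi_plus rho = r%:E & E_c rho = (r^-1)%:E].
Proof.
have := rate_psi_plus_gt0 ent.1; have := rate_psi_plus_lty ent.
rewrite /E_c; case: (rate psi_plus rho) => [r| |] // _; rewrite lte_fin => r0.
by exists r; rewrite inver gt_eqF.
Qed.

Lemma dive_E_c x : x / E_c rho = x * rate psi_plus rho.
Proof.
by have [r [r0 -> ->]] := E_c_gt0_fin; rewrite inver invr_eq0 gt_eqF// invrK.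
Qed.

Lemma E_D_div_E_c_le_sym_ent : E_D rho / E_c rho <= sym_ent rho.
Proof.
rewrite dive_E_c.
exact: roundtrip_rate_le_sym_ent ent.1 (state_psi_plus R) (swapop_psi_plus R).
Qed.

Lemma sym_ent_le1 : sym_ent rho <= 1.
Proof.
have [r [r0 rE _]] := E_c_gt0_fin.
have := rate_mul_sym_ent_le ent.1 (state_psi_plus R) (swapop_psi_plus R).
by rewrite rE -{2}[r%:E]mule1 lee_pmul2l.
Qed.

Lemma E_b_div_E_c : E_b rho / E_c rho = 1 - E_D rho / E_c rho.
Proof.
have [r [r0 rE EcE]] := E_c_gt0_fin.
by rewrite !dive_E_c rE /E_b EcE muleBl// ?fin_num_adde_defr// -EFinM mulVf ?gt_eqF.
Qed.

Lemma E_D_lt_E_c : E_D rho / E_c rho < 1 -> E_D rho < E_c rho.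
Proof.
have [r [r0 rE EcE]] := E_c_gt0_fin.
by rewrite dive_E_c rE EcE -[(r^-1)%:E]mul1e lte_pdivlMr.
Qed.

End SymmetryOfEntanglement.

Local Open Scope ereal_scope.

Theorem theorem2 (R : realType) (A B : finType) (rho : bop R A B) :
  entangled rho ->
  [/\ E_D rho / E_c rho <= sym_ent rho,
      sym_ent rho <= 1,
      asym_ent rho <= E_b rho / E_c rho
    & 0 < asym_ent rho -> E_D rho < E_c rho].
Proof.
move=> ent; have D_le_S := E_D_div_E_c_le_sym_ent ent.
split=> //; first exact: sym_ent_le1.
- by rewrite E_b_div_E_c//; exact: leeB.
- rewrite /asym_ent sube_gt0 => S_lt1.
  exact/E_D_lt_E_c/(le_lt_trans D_le_S).
Qed.
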